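(* Let $V$ be a vertex operator superalgebra equipped with a normalized scalar product $(\cdot|\cdot)$. Then the following are equivalent: (i) $(V,(\cdot|\cdot))$ is a unitary VOSA. (ii) There exists an antilinear vector space involution $V\ni a\mapsto\overline{a}\in V$ such that $\overline{\nu}=\nu$ and $(a_nb|c)=(b|\overline{a}_{-n}c)$ for all $a,b,c\in V$ and all $n\in\frac12\mathbb{Z}$. Furthermore, $\overline{\Omega}=\Omega$ and the PCT operator $\theta$ is related to the antilinear involution in (ii) by the formula $$\overline{a}=e^{L_1}(-1)^{2L_0^2+L_0}\theta(a)\qquad\forall a\in V.$$
   Context: **VOSA.** A vertex operator superalgebra (VOSA) $V=(V,\Omega,T,Y,\nu)$ consists of a complex vector superspace $V=V_{\bar 0}\oplus V_{\bar 1}$, an even vector $\Omega$ (vacuum), an even endomorphism $T$, and a linear parity-preserving map $a\mapsto Y(a,z)=\sum_{n\in\mathbb{Z}}a_{(n)}z^{-n-1}\in \mathrm{End}(V)[[z,z^{-1}]]$ such that for all $a,b$: $a_{(n)}b=0$ for $n$ large; $[T,Y(a,z)]=\frac{d}{dz}Y(a,z)$; $Y(\Omega,z)=1_V$, $T\Omega=0$, $a_{(-1)}\Omega=a$; $(z-w)^N[Y(a,z),Y(b,w)]=0$ for $N$ large (graded commutator); together with an even vector $\nu$ (conformal vector) such that $L_n:=\nu_{(n+1)}$ satisfy the Virasoro relations with some central charge, $L_{-1}=T$, $L_0$ is diagonalizable with eigenspaces $V_n=\ker(L_0-n)$, $V_{\bar0}=\bigoplus_{n\in\mathbb{Z}}V_n$,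 $V_{\bar1}=\bigoplus_{n\in\mathbb{Z}-\frac12}V_n$, $\dim V_n<\infty$, $V_n=0$ for $n$ sufficiently negative. A non-zero $a\in V_{d_a}$ is homogeneous of conformal weight $d_a$; then $a_n:=a_{(n+d_a-1)}$ for $n\in\mathbb{Z}-d_a$ and $a_n:=0$ for the other $n\in\frac12\mathbb{Z}$; $a_n$ is defined for all $a\in V$, $n\in\frac12\mathbb{Z}$, by linearity in $a$. **Unitary VOSA.** A scalar product (positive-definite Hermitian form, linear in the second variable) is normalized if $(\Omega|\Omega)=1$. $(V,(\cdot|\cdot))$, with $(\cdot|\cdot)$ normalized, is a unitary VOSA if there is an antilinear bijection $\theta$ of $V$ (the PCT operator; it is unique) preserving $(n)$-products, $\Omega$ and $\nu$, with $\theta^2=1$, such that $(Y(\theta(a),z)b|c)=(b|Y(e^{zL_1}(-1)^{2L_0^2+L_0}z^{-2L_0}a,z^{-1})c)$ for all $a,b,c\in V$. The operator $(-1)^{2L_0^2+L_0}$ acts on $V_d$ as $(-1)^{2d^2+d}$, which equals $(-1)^d$ for $d\in\mathbb{Z}$ and $(-1)^{d+\frac12}$ for $d\in\mathbb{Z}-\frac12$. *)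

(* Defs.v *)
From HB Require Import structures.
From mathcomp Require Import all_boot all_order all_algebra.
From mathcomp Require Import all_real_closed.
From mathcomp Require Import boolp classical_sets functions cardinality fsbigop.
From mathcomp Require Import reals.

Set Implicit Arguments.
Unset Strict Implicit.
Unset Printing Implicit Defensive.

Import Order.TTheory GRing.Theory Num.Theory.

Local Open Scope classical_set_scope.
Local Open Scope ring_scope.

(* Complex numbers are R[i] for R : realType. A half-integer n (a conformal
   weight or a mode index) is always encoded by the integer k = 2n. *)

(* par false and par true are the even and the odd subspace, and nprod a n is
   the coefficient a_(n) of z^(-n-1) in Y(a,z). *)
Record vosa_data (R : realType) (V : lmodType R[i]) := VosaData {
  par : bool -> set V;
  vac : V;
  transl : {linear V -> V};
  nprod : V -> int -> {linear V -> V};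
  conf : V
}.

Section VOSA.
Variables (R : realType) (V : lmodType R[i]) (A : vosa_data V).
Local Notation C := R[i].
Local Notation Y := (nprod A).

Definition is_subspace (S : set V) : Prop :=
  S 0 /\ forall (x : C) u v, S u -> S v -> S (x *: u + v).

(* Coefficient of z^(-m-1) w^(-n-1) in the graded commutator [Y(a,z), Y(b,w)] v,
   for a of parity p and b of parity q. *)
Definition gcomm (p q : bool) (a b v : V) (m n : int) : V :=
  Y a m (Y b n v) - (-1) ^+ (p && q) *: Y b n (Y a m v).

(* Multiplication by (z - w) of a two-variable formal distribution whose
   coefficient of z^(-m-1) w^(-n-1) is F m n. *)
Definition mul_zw (F : int -> int -> V) : int -> int -> V :=
  fun m n => F (m + 1) n - F m (n + 1).

Definition L (n : int) : {linear V -> V} := Y (conf A) (n + 1).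

(* The eigenspace V_(k/2). *)
Definition wt (k : int) : set V :=
  [set v | L 0 v = (k%:~R / 2 : C) *: v].

(* f is a decomposition of v into finitely many components f k in V_(k/2). *)
Definition hdecomp (f : int -> V) (v : V) : Prop :=
  [/\ forall k, wt k (f k),
      finite_set [set k | f k != 0]
    & v = \sum_(k \in [set: int]) f k].

Record is_vosa : Prop := IsVosa {
  vosa_par_sub : forall p, is_subspace (par A p);
  vosa_par_sum : forall v,
    exists v0 v1, [/\ par A false v0, par A true v1 & v = v0 + v1];
  vosa_par_direct : par A false `&` par A true = [set 0];
  vosa_vac_even : par A false (vac A);
  vosa_transl_even : forall p a, par A p a -> par A p (transl A a);
  vosa_Y_linear : forall n b, linear (fun a => Y a n b);
  vosa_Y_par : forall p q a b n,
    par A p a -> par A q b -> par A (p (+) q) (Y a n b);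
  vosa_Y_trunc : forall a b, exists N : int, forall n, N <= n -> Y a n b = 0;
  vosa_Y_transl : forall a n b,
    transl A (Y a n b) - Y a n (transl A b) = - n%:~R *: Y a (n - 1) b;
  vosa_Y_vac : forall n b, Y (vac A) n b = if n == -1 then b else 0;
  vosa_transl_vac : transl A (vac A) = 0;
  vosa_creation : forall a, Y a (-1) (vac A) = a;
  vosa_locality : forall p q a b, par A p a -> par A q b ->
    exists N0 : nat, forall N : nat, (N0 <= N)%N ->
      forall v m n, iter N mul_zw (gcomm p q a b v) m n = 0;
  vosa_conf_even : par A false (conf A);
  vosa_virasoro : exists c : C, forall m n v,
    L m (L n v) - L n (L m v) =
      (m - n)%:~R *: L (m + n) v
      + (if m + n == 0 then c / 12 * (m ^+ 3 - m)%:~R else 0) *: v;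
  vosa_L_transl : forall v, L (-1) v = transl A v;
  vosa_L0_diag : forall v, exists f, hdecomp f v;
  vosa_par_wt : forall p, par A p =
    [set v | exists f, hdecomp f v /\
                       forall k : int, f k != 0 -> odd `|k|%N = p];
  vosa_wt_fin : forall k, exists (d : nat) (e : 'I_d -> V),
    wt k = [set \sum_i x i *: e i | x in [set: 'I_d -> C]];
  vosa_wt_bounded : exists K : int, forall k, k < K -> wt k = [set 0]
}.

(* All the infinite-range sums below have finite support in a VOSA: conformal
   weights are bounded below, and L_1 lowers them by 1. *)

(* hcomp a k is the component of a in V_(k/2). *)
Definition hcomp (a : V) : int -> V := xget (fun=> 0) [set f | hdecomp f a].

(* mode a k is a_n with n = k/2: the component of a of weight d/2 contributes
   its (n + d/2 - 1)-product if n + d/2 is an integer, and 0 otherwise. *)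
Definition mode (a : V) (k : int) (b : V) : V :=
  \sum_(d \in [set: int])
    (if (2 %| k + d)%Z then Y (hcomp a d) (((k + d) %/ 2)%Z - 1) b else 0).

(* (-1)^(2 L_0^2 + L_0): for weight k/2, 2 (k/2)^2 + k/2 = k (k + 1) / 2. *)
Definition sgnL0 (a : V) : V :=
  \sum_(k \in [set: int]) ((-1) ^ (k * (k + 1) %/ 2)%Z : C) *: hcomp a k.

Definition expL1 (a : V) : V :=
  \sum_(j \in [set: nat]) (j`!%:R^-1 : C) *: iter j (L 1) a.

(* Formal series in z with coefficients in V: F i is the coefficient of z^i. *)

(* z^(-2 L_0) a, where z^(-2 L_0) acts on V_(k/2) as z^(-k) *)
Definition zpowL0 (a : V) : int -> V := fun i => hcomp a (- i).

(* e^(z L_1) F(z) *)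
Definition expzL1 (F : int -> V) : int -> V := fun i =>
  \sum_(j \in [set: nat]) (j`!%:R^-1 : C) *: iter j (L 1) (F (i - j%:Z)).

(* Coefficient of z^(-n-1) in Y(F(z), z^-1) c: the term of F of degree i
   contributes F_i_(m) z^(i + m + 1), so m = - n - 2 - i. *)
Definition Yinv (F : int -> V) (n : int) (c : V) : V :=
  \sum_(i \in [set: int]) Y (F i) (- n - 2 - i) c.

Definition antilinear (f : V -> V) : Prop :=
  forall (x : C) u v, f (x *: u + v) = x^* *: f u + f v.

Definition normalized_scalar_product (dot : V -> V -> C) : Prop :=
  [/\ forall u (x : C) v w, dot u (x *: v + w) = x * dot u v + dot u w,
      forall u v, dot v u = (dot u v)^*,
      forall v, v != 0 -> 0 < dot v v
    & dot (vac A) (vac A) = 1].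

Record is_PCT (dot : V -> V -> C) (theta : V -> V) : Prop := IsPCT {
  PCT_antilinear : antilinear theta;
  PCT_bij : bijective theta;
  PCT_nprod : forall a n b, theta (Y a n b) = Y (theta a) n (theta b);
  PCT_vac : theta (vac A) = vac A;
  PCT_conf : theta (conf A) = conf A;
  PCT_invol : forall a, theta (theta a) = a;
  (* invariance, coefficient of z^(-n-1) *)
  PCT_invariant : forall a b c n,
    dot (Y (theta a) n b) c =
    dot b (Yinv (expzL1 (fun i => sgnL0 (zpowL0 a i))) n c)
}.

Definition unitary_vosa (dot : V -> V -> C) : Prop :=
  [/\ is_vosa, normalized_scalar_product dot & exists theta, is_PCT dot theta].

Record adjoint_involution (dot : V -> V -> C) (bar : V -> V) : Prop :=
  AdjointInvolution {
  adj_antilinear : antilinear bar;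
  adj_invol : forall a, bar (bar a) = a;
  adj_conf : bar (conf A) = conf A;
  adj_mode : forall a b c k, dot (mode a k b) c = dot b (mode (bar a) (- k) c)
}.

End VOSA.

(* Main.v *)
(** Given the PCT operator [theta], the involution is [bar = E theta] with
    [E = e^(L_1) (-1)^(2 L_0^2 + L_0)]: comparing coefficients, the invariance
    of the scalar product says that [(E (theta a))_(-n)] is adjoint to [a_n],
    and [E^2 = 1].

    Conversely put [theta = E bar].  Taking adjoints in the commutators of
    [L_1] and [L_(-1)] with the modes of [a] shows how [bar] fails to commute
    with [L_0], [L_1] and [T]; since [E] fails in the same way, [theta] commutes
    with all three and is an involution.  It preserves the (n)-products: for
    quasi-primary [a] and [b], take the adjoint of the Borcherds identity for
    [a_(n) b].  The result is the Borcherds identity for [theta a], [theta b] at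
    reflected indices, whose associativity side is exactly
    [e^(L_1) (theta(a)_(n) theta(b))].  As [T] and [L_1] are mutually adjoint
    and the scalar product is positive, [V] is spanned by the [T^k u] with [u]
    quasi-primary, and the general case follows.  The Borcherds identity itself
    is deduced from locality through Dong's lemma. *)

Require Import Defs.
From mathcomp Require Import all_boot all_order all_algebra.
From mathcomp Require Import all_real_closed.
From mathcomp Require Import boolp classical_sets functions cardinality fsbigop.
From mathcomp Require Import reals.
From mathcomp Require Import zify ring.

Set Implicit Arguments.
Unset Strict Implicit.
Unset Printing Implicit Defensive.

Import Order.TTheory GRing.Theory Num.Theory.

Local Open Scope classical_set_scope.
Local Open Scope ring_scope.

(** * Finitely supported sums *)

Section FiniteSupport.
Variables (K : pzRingType) (V : lmodType K).

(** The support is bounded by a list, so that several sums can be rewritten over one common list and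
    compared as ordinary big operators. *)
Definition fsupp (I : choiceType) (f : I -> V) : Prop :=
  exists s : seq I, forall i, i \notin s -> f i = 0.

Lemma fsum_seq (I : choiceType) (s : seq I) (f : I -> V) : uniq s ->
  (forall i, i \notin s -> f i = 0) ->
  \sum_(i \in [set: I]) f i = \sum_(i <- s) f i.
Proof.
move=> us fs; rewrite (@fsbigE _ _ _ _ _ s) //; last by move=> i _; exact: fs.
by apply: eq_bigl => i; rewrite in_setT.
Qed.

Lemma fsum_ord (N : nat) (f : nat -> V) :
  (forall j, (N <= j)%N -> f j = 0) ->
  \sum_(j \in [set: nat]) f j = \sum_(j < N) f j.
Proof.
move=> fN; rewrite (@fsum_seq _ (iota 0 N)) ?iota_uniq //.
  by rewrite -(big_mkord xpredT) /index_iota subn0.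
by move=> i; rewrite mem_iota add0n /= -leqNgt => /fN.
Qed.

Lemma fsupp_nat (N : nat) (f : nat -> V) :
  (forall j, (N <= j)%N -> f j = 0) -> fsupp f.
Proof.
by move=> fN; exists (iota 0 N) => i; rewrite mem_iota add0n /= -leqNgt => /fN.
Qed.

Lemma fsum1 (I : choiceType) (i0 : I) (f : I -> V) :
  (forall i, i != i0 -> f i = 0) -> \sum_(i \in [set: I]) f i = f i0.
Proof.
move=> f0; rewrite (@fsum_seq _ [:: i0]) ?big_seq1 // => i.
by rewrite inE; apply: f0.
Qed.

Lemma fsupp_lin (I : choiceType) (x : K) (f g : I -> V) :
  fsupp f -> fsupp g -> fsupp (fun i => x *: f i + g i).
Proof.
move=> [s fs] [t gt]; exists (s ++ t) => i.
by rewrite mem_cat negb_or => /andP[/fs -> /gt ->]; rewrite scaler0 addr0.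
Qed.

Lemma fsum_lin (I : choiceType) (x : K) (f g : I -> V) :
  fsupp f -> fsupp g ->
  \sum_(i \in [set: I]) (x *: f i + g i) =
  x *: \sum_(i \in [set: I]) f i + \sum_(i \in [set: I]) g i.
Proof.
move=> [s fs] [t gt]; pose r := undup (s ++ t).
have ur : uniq r by exact: undup_uniq.
have fr i : i \notin r -> f i = 0.
  by rewrite mem_undup mem_cat negb_or => /andP[/fs].
have gr i : i \notin r -> g i = 0.
  by rewrite mem_undup mem_cat negb_or => /andP[_ /gt].
rewrite !(fsum_seq ur) // ?big_split ?scaler_sumr //.
by move=> i ir; rewrite fr // gr // scaler0 addr0.
Qed.

End FiniteSupport.

Lemma fsum_linear (K : pzRingType) (V W : lmodType K) (h : {linear V -> W})
    (I : choiceType) (f : I -> V) : fsupp f ->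
  h (\sum_(i \in [set: I]) f i) = \sum_(i \in [set: I]) h (f i).
Proof.
move=> [s fs]; have us := undup_uniq s.
have fr i : i \notin undup s -> f i = 0 by rewrite mem_undup; exact: fs.
rewrite !(fsum_seq us) ?linear_sum // => i /fr ->; exact: linear0.
Qed.

(** Descending induction: it carries vanishing from large indices, where truncation or locality
    provides it, to all integers. *)
Lemma intP1 (P : int -> Prop) (N : int) :
  (forall n, N <= n -> P n) -> (forall n, P (n + 1) -> P n) -> forall n, P n.
Proof.
move=> PN Pd n.
have H (k : nat) : P (N - k%:Z).
  elim: k => [|k IH]; first by apply: PN; lia.
  by apply: Pd; rewrite (_ : _ + 1 = N - k%:Z) //; lia.
have [?|?] := leP N n; first exact: PN.
by rewrite (_ : n = N - `|N - n|%N%:Z); [exact: H | lia].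
Qed.

(** * Binomial coefficients with an arbitrary integer on top *)

Section Binomial.
Variable C : numFieldType.

Definition binz (x : int) (j : nat) : C :=
  (\prod_(i < j) (x - i%:Z)%:~R) / j`!%:R.

Lemma binz0 x : binz x 0 = 1.
Proof. by rewrite /binz big_ord0 fact0 divr1. Qed.

Lemma binz_rec x j : j.+1%:R * binz x j.+1 = (x - j%:Z)%:~R * binz x j.
Proof.
have h : (j`!%:R : C) != 0 by rewrite pnatr_eq0 -lt0n fact_gt0.
have h' : (j.+1%:R : C) != 0 by rewrite pnatr_eq0.
rewrite /binz big_ord_recr /= factS natrM.
by field; rewrite h addrC natr1 h'.
Qed.

Lemma binzD1 x j : binz (x + 1) j.+1 = binz x j.+1 + binz x j.
Proof.
elim: j => [|j IH].
  have := binz_rec (x + 1) 0; have := binz_rec x 0.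
  by rewrite !binz0 !mul1r !mulr1 => -> ->; ring.
have h' : (j.+2%:R : C) != 0 by rewrite pnatr_eq0.
apply: (mulfI h'); rewrite mulrDr !binz_rec IH mulrDr.
rewrite -[j.+2%:R]/((j.+1).+1%:R) -(@natr1 C j.+1) [in RHS]mulrDl binz_rec; ring.
Qed.

Lemma binz0n j : binz 0 j.+1 = 0.
Proof. by rewrite /binz big_ord_recl /= subr0 !mul0r. Qed.

Lemma binz1 : binz 1 1 = 1.
Proof. by rewrite (binzD1 0) binz0n binz0 add0r. Qed.

Lemma binz1n j : binz 1 j.+2 = 0.
Proof. by rewrite (binzD1 0) !binz0n addr0. Qed.

Lemma binz21 : binz 2 1 = 2.
Proof. by rewrite (binzD1 1) binz1 binz0. Qed.

Lemma binz22 : binz 2 2 = 1.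
Proof. by rewrite (binzD1 1) binz1n binz1 add0r. Qed.

Lemma binz2n j : binz 2 j.+3 = 0.
Proof. by rewrite (binzD1 1) !binz1n addr0. Qed.

End Binomial.

(** * Expansions of [(z - w)^n] *)

Section Expansion.
Variables (R : realType) (V : lmodType R[i]).
Local Notation C := R[i].
Implicit Types F : int -> int -> V.

(* Coefficients of (z - w)^n F(z, w), with (z - w)^n expanded in |z| > |w|. *)
Definition expand (n : int) F (m k : int) : V :=
  \sum_(j \in [set: nat]) ((-1) ^+ j * binz C n j) *: F (m + n - j%:Z) (k + j%:Z).

(** The bound on [k] is uniform in [m], so each coefficient of [expand] receives finitely many
    terms. Truncation of [Y b k v] is the source of such bounds. *)
Definition wbounded F := exists K : int, forall m k, K <= k -> F m k = 0.

Lemma expand_ord n F (K : int) m k (N : nat) :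
  (forall m k, K <= k -> F m k = 0) -> K <= k + N%:Z ->
  expand n F m k =
    \sum_(j < N) ((-1) ^+ j * binz C n j) *: F (m + n - j%:Z) (k + j%:Z).
Proof.
move=> FK KN; apply: fsum_ord => j Nj.
by rewrite FK ?scaler0 //; lia.
Qed.

Lemma expand0 F m k : expand 0 F m k = F m k.
Proof.
rewrite /expand (@fsum1 _ _ _ 0%N).
  by rewrite binz0 expr0 mulr1 scale1r; congr F; lia.
by case=> // j _; rewrite binz0n mulr0 scale0r.
Qed.

(** Pascal's rule, read as [(z - w) (z - w)^n = (z - w)^(n+1)]. *)
Lemma mul_zw_expand n F m k : wbounded F ->
  mul_zw (expand n F) m k = expand (n + 1) F m k.
Proof.
case=> K FK; pose N := `|K - k|%N; rewrite /mul_zw.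
rewrite (@expand_ord _ _ K _ _ N.+1) //; last lia.
(* At [k + 1] one term fewer suffices; once the terms [j = 0] of the other two sums are split off,
   all three have length [N]. *)
rewrite (@expand_ord _ _ K m _ N) //; last lia.
rewrite (@expand_ord _ _ K _ _ N.+1) //; last lia.
rewrite !big_ord_recl /= !binz0 -addrA; congr (_ + _).
  by congr (_ *: F _ _); lia.
rewrite -sumrB; apply: eq_bigr => i _; rewrite /bump /= add1n.
rewrite binzD1 mulrDr scalerDl; congr (_ + _).
  by congr (_ *: F _ _); lia.
by rewrite exprS mulN1r mulNr scaleNr; congr (- (_ *: F _ _)); lia.
Qed.

Lemma expand_bounded n F (K : int) :
  (forall m k, K <= k -> F m k = 0) -> forall m k, K <= k -> expand n F m k = 0.
Proof.
by move=> FK m k Kk; rewrite (@expand_ord _ _ K _ _ 0) ?big_ord0 //; lia.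
Qed.

Lemma expandD n F G m k : wbounded F -> wbounded G ->
  expand n (fun m k => F m k + G m k) m k = expand n F m k + expand n G m k.
Proof.
move=> [K FK] [K' GK]; pose M := Num.max K K'.
have FM m' k' : M <= k' -> F m' k' = 0 by rewrite ge_max => /andP[/FK].
have GM m' k' : M <= k' -> G m' k' = 0 by rewrite ge_max => /andP[_ /GK].
have MN : M <= k + `|M - k|%N%:Z by lia.
rewrite (expand_ord _ _ FM MN) (expand_ord _ _ GM MN).
rewrite (@expand_ord _ _ M _ _ `|M - k|%N) //; last first.
  by move=> m' k' Mk; rewrite FM // GM // addr0.
by rewrite -big_split; apply: eq_bigr => j _; rewrite scalerDr.
Qed.

Lemma expand_eq0 n F m k : (forall m k, F m k = 0) -> expand n F m k = 0.
Proof. by move=> F0; apply: fsbig1 => j _; rewrite F0 scaler0. Qed.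

End Expansion.

(** * Dong's lemma and the Borcherds identity *)

Section ThreeVariables.
Variable V : zmodType.
Implicit Types F G : int -> int -> int -> V.

Definition mul_zx F m k l := F (m + 1) k l - F m k (l + 1).
Definition mul_wx F m k l := F m (k + 1) l - F m k (l + 1).

Lemma eq_fun3 F G : (forall m k l, F m k l = G m k l) -> F = G.
Proof. by move=> FG; do 3!apply: funext => ?; exact: FG. Qed.

Lemma subr_swap (x y z t : V) : x - y - (z - t) = x - z - (y - t).
Proof. by rewrite !opprB addrACA [RHS]addrACA [- z + _]addrC. Qed.

Lemma mul_zx_wx F : mul_zx (mul_wx F) = mul_wx (mul_zx F).
Proof. by apply: eq_fun3 => m k l; exact: subr_swap. Qed.

Lemma iter_zx_wx i j F :
  iter i mul_zx (iter j mul_wx F) = iter j mul_wx (iter i mul_zx F).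
Proof.
elim: i F => // i IH F; rewrite !iterSr -IH; congr iter.
by elim: j F {IH} => // j IH F; rewrite !iterSr IH mul_zx_wx.
Qed.

Lemma mul_zxB F G : mul_zx (fun m k l => F m k l - G m k l) =
  fun m k l => mul_zx F m k l - mul_zx G m k l.
Proof. by apply: eq_fun3 => m k l; exact: subr_swap. Qed.

Lemma mul_wxB F G : mul_wx (fun m k l => F m k l - G m k l) =
  fun m k l => mul_wx F m k l - mul_wx G m k l.
Proof. by apply: eq_fun3 => m k l; exact: subr_swap. Qed.

Lemma iter_zxB i F G : iter i mul_zx (fun m k l => F m k l - G m k l) =
  fun m k l => iter i mul_zx F m k l - iter i mul_zx G m k l.
Proof. by elim: i F G => // i IH F G; rewrite !iterSr mul_zxB IH. Qed.

Lemma iter_wxB i F G : iter i mul_wx (fun m k l => F m k l - G m k l) =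
  fun m k l => iter i mul_wx F m k l - iter i mul_wx G m k l.
Proof. by elim: i F G => // i IH F G; rewrite !iterSr mul_wxB IH. Qed.

Lemma mul_zx0 i : iter i mul_zx (fun _ _ _ => 0) = fun _ _ _ => 0.
Proof.
by elim: i => //= i ->; apply: eq_fun3 => m k l; rewrite /mul_zx subr0.
Qed.

Lemma mul_wx0 i : iter i mul_wx (fun _ _ _ => 0) = fun _ _ _ => 0.
Proof.
by elim: i => //= i ->; apply: eq_fun3 => m k l; rewrite /mul_wx subr0.
Qed.

Definition mul_zw3 F m k l := F (m + 1) k l - F m (k + 1) l.

Lemma mul_zw_zx F : mul_zw3 (mul_zx F) = mul_zx (mul_zw3 F).
Proof. by apply: eq_fun3 => m k l; exact: subr_swap. Qed.

Lemma mul_zw_wx F : mul_zw3 (mul_wx F) = mul_wx (mul_zw3 F).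
Proof. by apply: eq_fun3 => m k l; exact: subr_swap. Qed.

Lemma mul_zw_iter i j F : mul_zw3 (iter i mul_zx (iter j mul_wx F)) =
  iter i mul_zx (iter j mul_wx (mul_zw3 F)).
Proof.
elim: i F => [|i IH] F.
  by elim: j F => //= j IH F; rewrite mul_zw_wx IH.
by rewrite /= mul_zw_zx IH.
Qed.

Definition wbounded3 F :=
  forall l, exists K : int, forall m k, K <= k -> F m k l = 0.

Lemma mul_zx_bounded F : wbounded3 F -> wbounded3 (mul_zx F).
Proof.
move=> bF l; have [K1 F1] := bF l; have [K2 F2] := bF (l + 1).
exists (Num.max K1 K2) => m k; rewrite ge_max => /andP[k1 k2].
by rewrite /mul_zx F1 // F2 // subr0.
Qed.

Lemma mul_wx_bounded F : wbounded3 F -> wbounded3 (mul_wx F).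
Proof.
move=> bF l; have [K1 F1] := bF l; have [K2 F2] := bF (l + 1).
exists (Num.max K1 K2) => m k; rewrite ge_max => /andP[k1 k2].
by rewrite /mul_wx F1 ?F2 ?subr0 //; lia.
Qed.

(* Multiplication by z - w is injective on distributions bounded in w, so the
   vanishing at [n = 0] propagates to negative [n]. *)
Lemma annihilated_expansion (T : int -> int -> int -> int -> V) i j :
  (forall n, mul_zw3 (T n) = T (n + 1)) -> (forall n, wbounded3 (T n)) ->
  iter i mul_zx (iter j mul_wx (T 0)) = (fun _ _ _ => 0) ->
  forall n, iter i mul_zx (iter j mul_wx (T n)) = fun _ _ _ => 0.
Proof.
move=> Trec Tb T0.
pose D n := iter i mul_zx (iter j mul_wx (T n)).
have Drec n : mul_zw3 (D n) = D (n + 1) by rewrite /D mul_zw_iter Trec.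
have Db n : wbounded3 (D n).
  rewrite /D; elim: i {T0 D Drec} => [|i' IH] /=; last exact: mul_zx_bounded.
  by elim: j => [|j' IH] //=; exact: mul_wx_bounded.
apply: (@intP1 _ 0) => [n n0|n].
  rewrite (_ : n = `|n|%N%:Z); last lia.
  elim: `|n|%N => // p IH.
  have := Drec p%:Z; rewrite (_ : p%:Z + 1 = p.+1%:Z); last lia.
  rewrite /D => <-; rewrite IH.
  by apply: eq_fun3 => m k l; rewrite /mul_zw3 subr0.
rewrite -!/(D _) -Drec => Dn; apply: eq_fun3 => m k l.
have [K DK] := Db n l.
(* [D n] is constant along [m + k = const], and moving far enough in that direction reaches the
   region where it vanishes. *)
have step m' k' : D n m' k' l = D n (m' - 1) (k' + 1) l.
  have := congr1 (fun f => f (m' - 1) k' l) Dn; rewrite /mul_zw3 subrK.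
  by move/subr0_eq.
have steps p : D n m k l = D n (m - p%:Z) (k + p%:Z) l.
  elim: p => [|p ->]; first by rewrite subr0 addr0.
  by rewrite step; congr D; lia.
by rewrite (steps `|K - k|%N) DK //; lia.
Qed.

(* Since z - x = (z - w) + (w - x), the powers of z - x can be traded for
   powers of w - x, up to terms with a higher power of z - w. *)
Lemma annihilated_wx (Q : int -> int -> int -> int -> V) i j (N : int) :
  (forall n, mul_zw3 (Q n) = Q (n + 1)) ->
  (forall n, iter i mul_zx (iter j mul_wx (Q n)) = fun _ _ _ => 0) ->
  (forall n, N <= n -> Q n = fun _ _ _ => 0) ->
  forall n, exists M : nat, iter M mul_wx (Q n) = fun _ _ _ => 0.
Proof.
move=> Qrec Qann QN; apply: (@intP1 _ N) => [n Nn|n [M QM]].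
  by exists 0%N; rewrite /= QN.
(* In the presence of [M] factors [w - x], one more factor [z - x] acts as [w - x]: their difference
   [z - w] raises [n] to [n + 1], where those [M] factors already annihilate. *)
have zx p q : iter p mul_zx (iter (M + q) mul_wx (Q n)) =
    iter (M + q + p) mul_wx (Q n).
  elim: p q => [|p IH] q; first by rewrite addn0.
  rewrite iterSr.
  rewrite (_ : mul_zx (iter (M + q) _ _) = iter (M + q.+1) mul_wx (Q n)).
    by rewrite IH; congr iter; lia.
  rewrite -[LHS]/(iter 1 mul_zx _) iter_zx_wx /=.
  rewrite (_ : mul_zx (Q n) =
    fun m k l => mul_wx (Q n) m k l - (- mul_zw3 (Q n) m k l)); last first.
    by apply: eq_fun3 => m k l; rewrite opprK addrC /mul_zw3 addrA subrK.
  rewrite (_ : (fun m k l => _ - _) =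
    fun m k l => mul_wx (Q n) m k l - (0 - Q (n + 1) m k l)); last first.
    by apply: eq_fun3 => m k l; rewrite -Qrec sub0r.
  rewrite iter_wxB (@iter_wxB _ (fun _ _ _ => 0)) mul_wx0.
  have -> : iter (M + q) mul_wx (Q (n + 1)) = fun _ _ _ => 0.
    by rewrite addnC iterD QM mul_wx0.
  by apply: eq_fun3 => m k l; rewrite !subr0 addnS iterSr.
exists (M + j + i)%N.
by rewrite -zx iterD iter_zx_wx Qann mul_wx0.
Qed.

End ThreeVariables.

(** * Products of fields, locality and uniqueness *)

Section Borcherds.
Variables (R : realType) (V : lmodType R[i]) (A : vosa_data V).
Hypothesis hA : is_vosa A.
Local Notation C := R[i].
Local Notation Y := (nprod A).
Local Notation T := (transl A).
Local Notation vac := (vac A).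

Lemma nprodD u v n b : Y (u + v) n b = Y u n b + Y v n b.
Proof. by have := vosa_Y_linear hA n b 1 u v; rewrite !scale1r. Qed.

Lemma nprod0 n b : Y 0 n b = 0.
Proof.
apply: (addIr (Y 0 n b)); rewrite -nprodD !addr0 add0r //.
Qed.

Lemma nprodZ x u n b : Y (x *: u) n b = x *: Y u n b.
Proof. by have := vosa_Y_linear hA n b x u 0; rewrite nprod0 !addr0. Qed.

(** Since [T] kills the vacuum, translation covariance makes [(n + 1) a_(n) vac] equal to
    [- T (a_(n+1) vac)], and [n + 1] is nonzero for [n >= 0]. *)
Lemma nprod_vac_ge0 a n : 0 <= n -> Y a n vac = 0.
Proof.
have [N YN] := vosa_Y_trunc hA a vac; move: n; apply: (@intP1 _ N) => [n Nn _|n].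
  exact: YN.
move=> IH n0; have := vosa_Y_transl hA a (n + 1) vac.
rewrite (vosa_transl_vac hA) IH; last lia.
rewrite !linear0 addr0 addrK => /esym/eqP; rewrite scaler_eq0 oppr_eq0 intr_eq0.
by case/orP => [/eqP ?|/eqP //]; exfalso; lia.
Qed.

(* Coefficient of z^(-m-1) w^(-k-1) in (z-w)^n Y(a,z) Y(b,w) - e (z-w)^n Y(b,w)
   Y(a,z), with (z-w)^n expanded in |z| > |w|, resp. in |w| > |z|; [e] is the
   sign of the graded commutator. *)
Definition bop (e : C) (a b : V) (n m k : int) (v : V) : V :=
  expand n (fun m k => Y a m (Y b k v)) m k -
  (e * (-1) ^ n) *: expand n (fun k m => Y b k (Y a m v)) k m.

Lemma wbounded_nprod2 a b v : wbounded (fun m k => Y a m (Y b k v)).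
Proof.
by have [N YN] := vosa_Y_trunc hA b v; exists N => m k /YN ->; exact: linear0.
Qed.

Lemma signzS (n : int) : (-1) ^ (n + 1) = - (-1) ^ n :> C.
Proof. by rewrite expfzDr ?oppr_eq0 ?oner_eq0 // expr1z mulrN1. Qed.

Lemma bop_rec e a b n m k v :
  bop e a b n (m + 1) k v - bop e a b n m (k + 1) v = bop e a b (n + 1) m k v.
Proof.
rewrite /bop subr_swap -/(mul_zw _ m k) (mul_zw_expand _ _ _ (wbounded_nprod2 _ _ _)).
congr (_ - _); rewrite -scalerBr -opprB -/(mul_zw _ k m).
rewrite (mul_zw_expand _ _ _ (wbounded_nprod2 _ _ _)).
by rewrite signzS mulrN scaleNr scalerN.
Qed.

Lemma bop_zero p q a b m k v :
  bop ((-1) ^+ (p && q)) a b 0 m k v = gcomm A p q a b v m k.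
Proof. by rewrite /bop !expand0 expr0z mulr1. Qed.

Lemma bop_iter p q a b (n : nat) m k v :
  bop ((-1) ^+ (p && q)) a b n%:Z m k v = iter n (@mul_zw R V) (gcomm A p q a b v) m k.
Proof.
elim: n m k => [|n IH] m k; first exact: bop_zero.
by rewrite (_ : n.+1%:Z = n%:Z + 1) -?bop_rec ?IH //; lia.
Qed.

Lemma bop_large p q a b : par A p a -> par A q b -> exists N : int,
  forall n, N <= n -> forall m k v, bop ((-1) ^+ (p && q)) a b n m k v = 0.
Proof.
move=> pa qb; have [N loc] := vosa_locality hA pa qb; exists N => n Nn m k v.
rewrite (_ : n = `|n|%N%:Z) ?bop_iter ?loc //; lia.
Qed.

(** Both sides agree at [k = -1] by the creation property, and [T] leads from [k] to [k - 1] by the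
    same rule on both sides, with the nonzero factor [- k]. *)
Lemma expand_nprod_vac a b n (k : int) : k <= -1 ->
  expand n (fun m k => Y a m (Y b k vac)) 0 k = Y (Y a n b) k vac.
Proof.
pose F m k := Y a m (Y b k vac).
have FK m k' : 0 <= k' -> F m k' = 0 by move=> ?; rewrite /F nprod_vac_ge0 // linear0.
have TF m k' : T (F m k') = - m%:~R *: F (m - 1) k' - k'%:~R *: F m (k' - 1).
  rewrite /F -(subrK (Y a m (T (Y b k' vac))) (T (Y a m _))).
  rewrite (vosa_Y_transl hA); congr (_ + _).
  have := vosa_Y_transl hA b k' vac.
  by rewrite (vosa_transl_vac hA) linear0 subr0 => ->; rewrite linearZ /= scaleNr.
(* [T] acts as [d/dz + d/dw], which kills [(z - w)^n]; the index 0 selects the residue in [z], on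
   which [d/dz] contributes nothing. *)
have TE k' : T (expand n F 0 k') = - k'%:~R *: expand n F 0 (k' - 1).
  pose N := `|k'|%N.
  rewrite (@expand_ord _ _ _ _ 0 _ _ N FK); last lia.
  rewrite (@expand_ord _ _ _ _ 0 _ _ N.+1 FK); last lia.
  rewrite linear_sum /= big_ord_recl /=.
  under eq_bigr do rewrite linearZ /= TF scalerBr !scalerA.
  rewrite sumrB.
  pose t (j : nat) := ((-1) ^+ j * binz C n j * (k' + j%:Z)%:~R) *:
    F (0 + n - j%:Z) (k' + j%:Z - 1).
  have -> : \sum_(j < N) ((-1) ^+ j * binz C n j * (k' + j%:Z)%:~R) *:
      F (0 + n - j%:Z) (k' + j%:Z - 1) = t 0%N + \sum_(j < N) t j.+1.
    transitivity (\sum_(j < N.+1) t j); last by rewrite big_ord_recl.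
    (* The boundary term: [N = |k'|] makes its factor [k' + N] zero when [k' <= 0], and otherwise
       [F] vanishes there. *)
    suff tN : t N = 0 by rewrite big_ord_recr /= tN addr0.
    rewrite /t; have [k0|k0] := leP k' 0; last by rewrite FK ?scaler0 //; lia.
    by rewrite (_ : k' + N%:Z = 0) ?mulr0 ?scale0r //; lia.
  rewrite opprD addrCA scalerDr; congr (_ + _).
    by rewrite /t !addr0 scaleNr scalerA mulrC.
  rewrite -sumrB scaler_sumr; apply: eq_bigr => j _.
  rewrite /t /bump /= add1n.
  have -> : F (0 + n - j.+1%:Z) (k' + j.+1%:Z - 1) =
            F (0 + n - j%:Z - 1) (k' + j%:Z) by congr F; lia.
  have -> : F (0 + n - j.+1%:Z) (k' - 1 + j.+1%:Z) =
            F (0 + n - j%:Z - 1) (k' + j%:Z) by congr F; lia.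
  rewrite scalerA -scalerBl; congr (_ *: _).
  rewrite add0r mulrN -[_ * (n - j%:Z)%:~R]mulrA [X in - (_ * X)]mulrC.
  rewrite -binz_rec exprS; ring.
have mem p : expand n F 0 (-1 - p%:Z) = Y (Y a n b) (-1 - p%:Z) vac.
  elim: p => [|p IH].
    rewrite subr0 (@expand_ord _ _ _ _ 0 _ _ 1 FK) // big_ord1 /=.
    rewrite binz0 mulr1 scale1r /F add0r !addr0.
    by rewrite !(vosa_creation hA).
  have Tn x : T (Y x (-1 - p%:Z) vac) =
      - (-1 - p%:Z)%:~R *: Y x (-1 - p.+1%:Z) vac.
    have := vosa_Y_transl hA x (-1 - p%:Z) vac.
    rewrite (vosa_transl_vac hA) linear0 subr0 => ->.
    by congr (_ *: Y _ _ _); lia.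
  have := TE (-1 - p%:Z); rewrite IH Tn.
  rewrite (_ : -1 - p%:Z - 1 = -1 - p.+1%:Z); last lia.
  move=> /esym/eqP; rewrite -subr_eq0 -scalerBr scaler_eq0 oppr_eq0 intr_eq0.
  by case/orP => [/eqP ?|]; [exfalso; lia | rewrite subr_eq0 => /eqP].
by move=> k1; have -> : k = -1 - (absz (k + 1))%:Z; [lia | exact: mem].
Qed.

Lemma bop_vac e a b n k : bop e a b n 0 k vac = Y (Y a n b) k vac.
Proof.
have -> : bop e a b n 0 k vac = expand n (fun m k => Y a m (Y b k vac)) 0 k.
  rewrite /bop [X in _ *: X]fsbig1 ?scaler0 ?subr0 // => j _.
  by rewrite nprod_vac_ge0 ?linear0 ?scaler0 //; lia.
have [k0|k0] := leP 0 k; last by apply: expand_nprod_vac; lia.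
rewrite [RHS]nprod_vac_ge0 // (@expand_bounded _ _ _ _ 0) // => m k' ?.
by rewrite nprod_vac_ge0 // linear0.
Qed.

(* Coefficients of [Y(a,z) Y(b,w), Y(c,x)] times the expansion of (z-w)^n in
   |z| > |w|; [h] is the sign of the graded commutator. *)
Definition triple (h : C) a b c v (n m k l : int) : V :=
  expand n (fun m k => Y a m (Y b k (Y c l v))) m k -
  h *: Y c l (expand n (fun m k => Y a m (Y b k v)) m k).

Lemma triple_rec h a b c v n :
  mul_zw3 (triple h a b c v n) = triple h a b c v (n + 1).
Proof.
apply: eq_fun3 => m k l; rewrite /mul_zw3 /triple subr_swap -scalerBr -linearB.
by rewrite -!mul_zw_expand //; exact: wbounded_nprod2.
Qed.

Lemma triple_bounded h a b c v n : wbounded3 (triple h a b c v n).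
Proof.
move=> l; have [K1 F1] := wbounded_nprod2 a b (Y c l v).
have [K2 F2] := wbounded_nprod2 a b v.
exists (Num.max K1 K2) => m k; rewrite ge_max => /andP[k1 k2].
rewrite /triple (expand_bounded n F1) // (expand_bounded n F2) //.
by rewrite linear0 scaler0 subr0.
Qed.

Lemma iter_wx_nprod a (G : int -> int -> V) j :
  iter j (@mul_wx V) (fun m k l => Y a m (G k l)) =
  fun m k l => Y a m (iter j (@mul_zw R V) G k l).
Proof.
elim: j G => // j IH G; rewrite !iterSr -IH; congr iter.
by apply: eq_fun3 => m k l; rewrite /mul_wx -linearB.
Qed.

Lemma iter_zx_scale (x : C) (H : int -> int -> int -> V) j :
  iter j (@mul_zx V) (fun m k l => x *: H k m l) =
  fun m k l => x *: iter j (@mul_zw R V) (H k) m l.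
Proof.
elim: j => //= j ->; apply: eq_fun3 => m k l.
by rewrite /mul_zx -scalerBr.
Qed.

(** At [n = 0] the graded Leibniz rule expresses the commutator with [c] through those of [b, c] and
    [a, c], each killed by locality. [annihilated_expansion] extends this to every [n]. *)
Lemma triple_annihilated p q r a b c v : par A p a -> par A q b -> par A r c ->
  exists N0 : nat, forall N, (N0 <= N)%N -> forall n,
  iter N (@mul_zx V) (iter N (@mul_wx V)
    (triple ((-1) ^+ (p && r) * (-1) ^+ (q && r)) a b c v n)) = fun _ _ _ => 0.
Proof.
move=> pa qb rc; have [N1 loc1] := vosa_locality hA pa rc.
have [N2 loc2] := vosa_locality hA qb rc.
exists (maxn N1 N2) => N; rewrite geq_max => /andP[le1 le2].
apply: annihilated_expansion => [n|n|].
- exact: triple_rec.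
- exact: triple_bounded.
have -> : triple ((-1) ^+ (p && r) * (-1) ^+ (q && r)) a b c v 0 =
    fun m k l => Y a m (gcomm A q r b c v k l) -
      (- (-1) ^+ (q && r)) *: gcomm A p r a c (Y b k v) m l.
  apply: eq_fun3 => m k l; rewrite /triple !expand0 /gcomm.
  rewrite (linearB (Y a m)) [Y a m (_ *: _)]linearZ_LR scaleNr opprK [in RHS]scalerBr scalerA.
  rewrite addrA; by rewrite subrK [in RHS]mulrC.
rewrite iter_wxB iter_zxB iter_wx_nprod.
have -> : (fun m k l => Y a m (iter N (@mul_zw R V) (gcomm A q r b c v) k l)) =
    fun _ _ _ => 0.
  by apply: eq_fun3 => m k l; rewrite loc2 // linear0.
rewrite mul_zx0 iter_zx_wx.
rewrite (@iter_zx_scale _ (fun k m l => gcomm A p r a c (Y b k v) m l)).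
rewrite (_ : (fun m k l => _ *: _) = fun _ _ _ => 0); last first.
  by apply: eq_fun3 => m k l; rewrite loc1 // scaler0.
by rewrite mul_wx0; apply: eq_fun3 => m k l; rewrite subr0.
Qed.

(** Exchanging [z] and [w] exchanges the two multiplications; this handles the half of [bop] in
    which [b] acts last. *)
Lemma iter_wx_swap (x : C) (H : int -> int -> int -> V) i j :
  iter i (@mul_zx V) (iter j (@mul_wx V) (fun m k l => x *: H k m l)) =
  fun m k l => x *: iter i (@mul_wx V) (iter j (@mul_zx V) H) k m l.
Proof.
elim: i => /= [|i ->].
  elim: j => //= j ->; apply: eq_fun3 => m k l.
  by rewrite /mul_wx -scalerBr.
by apply: eq_fun3 => m k l; rewrite /mul_zx -scalerBr.
Qed.

(* Dong's lemma. *)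
Lemma bop_locality p q r a b c v n : par A p a -> par A q b -> par A r c ->
  exists M : nat, iter M (@mul_wx V) (fun m k l =>
    bop ((-1) ^+ (p && q)) a b n m k (Y c l v) -
    ((-1) ^+ (p && r) * (-1) ^+ (q && r)) *:
      Y c l (bop ((-1) ^+ (p && q)) a b n m k v)) = fun _ _ _ => 0.
Proof.
move=> pa qb rc; set e := (-1) ^+ (p && q); set h := _ * _.
have [N1 ann1] := triple_annihilated v pa qb rc.
have [N2 ann2] := triple_annihilated v qb pa rc.
have [N3 bopN] := bop_large pa qb.
pose N := maxn N1 N2.
move: n; apply: (@annihilated_wx _ _ N N N3) => n; last first.
- move=> N3n; apply: eq_fun3 => m k l.
  by rewrite /e !bopN // linear0 scaler0 subr0.
- rewrite [X in iter N (@mul_wx V) X](_ : _ = fun m k l => triple h a b c v n m k l -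
      (e * (-1) ^ n) *: triple h b a c v n k m l); last first.
    apply: eq_fun3 => m k l; rewrite /bop /triple (linearB (Y c l)).
    rewrite [Y c l (_ *: _)]linearZ_LR [h *: (_ - _)]scalerBr [_ *: (_ - h *: _)]scalerBr.
    by rewrite subr_swap !scalerA [h * _]mulrC.
  rewrite iter_wxB iter_zxB ann1 ?leq_maxl // (@iter_wx_swap _ (triple h b a c v n)).
  rewrite -iter_zx_wx /h [in triple _]mulrC ann2 ?leq_maxr //.
  by apply: eq_fun3 => m k l; rewrite scaler0 subr0.
- apply: eq_fun3 => m k l; rewrite /mul_zw3 subr_swap -scalerBr.
  rewrite -(linearB (Y c l)).
  by rewrite (bop_rec e a b n m k (Y c l v)) (bop_rec e a b n m k v).
Qed.

Lemma iter_wx_zw M (F : int -> int -> int -> V) m k l :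
  iter M (@mul_wx V) F m k l = iter M (@mul_zw R V) (F m) k l.
Proof. by elim: M k l => //= M IH k l; rewrite /mul_wx /mul_zw !IH. Qed.

(** [G] has only nonnegative powers of [x], so at [x = 0] the factor [(w - x)^M] reduces to [w^M], a
    mere shift of [k]. *)
Lemma annihilated_creation M (G : int -> int -> V) :
  (forall k l, 0 <= l -> G k l = 0) ->
  (forall k l, iter M (@mul_zw R V) G k l = 0) -> forall k, G k (-1) = 0.
Proof.
move=> G0 GM k.
suff H : forall k, iter M (@mul_zw R V) G k (-1) = G (k + M%:Z) (-1).
  by have := H (k - M%:Z); rewrite GM subrK => <-.
elim: M G G0 {k GM} => [|M IH] G G0 k; first by congr G; lia.
rewrite iterSr IH => [|k' l l0]; last by rewrite /mul_zw !G0 ?subr0 //; lia.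
by rewrite /mul_zw [X in _ - X]G0 // subr0; congr G; lia.
Qed.

Lemma sign_xorb p q r :
  (-1) ^+ (p && r) * (-1) ^+ (q && r) = (-1) ^+ ((p (+) q) && r) :> C.
Proof. by case: p q r => [] [] [] /=; ring. Qed.

(** Goddard's uniqueness argument: the two fields agree on the vacuum and are both local with every
    [Y(c, x)], hence they agree on [c_(-1) vac = c]. *)
Lemma bop_nprod p q a b n k v : par A p a -> par A q b ->
  bop ((-1) ^+ (p && q)) a b n 0 k v = Y (Y a n b) k v.
Proof.
move=> pa qb; set e := (-1) ^+ (p && q).
have bopD u w : bop e a b n 0 k (u + w) = bop e a b n 0 k u + bop e a b n 0 k w.
  rewrite /bop [RHS]addrACA -opprD -scalerDr.
  rewrite -!expandD; try exact: wbounded_nprod2.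
  have YD x y : (fun m k => Y x m (Y y k (u + w))) =
      fun m k => Y x m (Y y k u) + Y x m (Y y k w).
    by do 2!apply: funext => ?; rewrite (linearD (Y y _)) (linearD (Y x _)).
  by rewrite !YD.
suff H r c : par A r c -> bop e a b n 0 k c = Y (Y a n b) k c.
  have [v0 [v1 [p0 p1 ->]]] := vosa_par_sum hA v.
  by rewrite bopD (H _ _ p0) (H _ _ p1) linearD.
move=> rc; have [M1 Q1] := bop_locality vac n pa qb rc.
have [M2 loc] := vosa_locality hA (vosa_Y_par hA n pa qb) rc.
pose G k l := bop e a b n 0 k (Y c l vac) - Y (Y a n b) k (Y c l vac).
suff /(_ k) : forall k, G k (-1) = 0.
  by rewrite /G (vosa_creation hA) => /subr0_eq.
apply: (@annihilated_creation (M1 + M2)).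
  move=> k' l l0; rewrite /G nprod_vac_ge0 // linear0 subr0 /bop.
  rewrite !expand_eq0 ?scaler0 ?subr0 // => m k''; rewrite !linear0 //.
move=> k' l; set h := _ * _ in Q1.
pose Q m k l := bop e a b n m k (Y c l vac) - h *: Y c l (bop e a b n m k vac).
pose S (m k l : int) := gcomm A (p (+) q) r (Y a n b) c vac k l.
(* The terms with [Y c l] on the left cancel, because both fields agree on the vacuum. *)
have GE : (fun m k l => Q m k l - S m k l) 0 = G.
  do 2!apply: funext => ?; rewrite /Q /S /G /gcomm bop_vac /h sign_xorb.
  by rewrite subr_swap subrr subr0.
rewrite -GE -(iter_wx_zw _ (fun m k l => Q m k l - S m k l)) iter_wxB /S.
rewrite [in X in X - _]addnC iterD Q1 mul_wx0 sub0r iter_wx_zw loc ?oppr0 //.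
exact: leq_addl.
Qed.

(** The associativity side of the Borcherds identity. *)
Definition assoc (a b : V) (n m k : int) (v : V) : V :=
  \sum_(j \in [set: nat]) binz C m j *: Y (Y a (n + j%:Z) b) (m + k - j%:Z) v.

Lemma assoc_ord (K : int) (N : nat) a b n m k v :
  (forall n, K <= n -> Y a n b = 0) -> K <= n + N%:Z ->
  assoc a b n m k v =
    \sum_(j < N) binz C m j *: Y (Y a (n + j%:Z) b) (m + k - j%:Z) v.
Proof.
move=> YK KN; apply: fsum_ord => j Nj.
by rewrite YK ?nprod0 ?scaler0 //; lia.
Qed.

Lemma assoc_rec a b (n m k : int) v :
  assoc a b n (m + 1) k v - assoc a b n m (k + 1) v = assoc a b (n + 1) m k v.
Proof.
have [K YK] := vosa_Y_trunc hA a b; pose N := `|K - n|%N.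
rewrite !(@assoc_ord K N.+1 a b n) ?(@assoc_ord K N a b (n + 1)) //; try lia.
rewrite !big_ord_recl !binz0 opprD addrACA.
rewrite (_ : m + 1 + k = m + (k + 1)) ?subrr ?add0r; last lia.
rewrite -sumrB; apply: eq_bigr => j _.
rewrite lift0 -scalerBl binzD1 addrAC subrr add0r.
by congr (_ *: Y (Y _ _ _) _ _); lia.
Qed.

(** Both sides satisfy the same recursion and vanish for large [n]. If the difference vanishes at
    [n + 1], then at [n] it depends on [m + k] only, and the case [m = 0] is [bop_nprod]. *)
Theorem borcherds_identity p q a b n m k v : par A p a -> par A q b ->
  bop ((-1) ^+ (p && q)) a b n m k v = assoc a b n m k v.
Proof.
move=> pa qb; set e := _ ^+ _.
have [N1 bopN] := bop_large pa qb; have [N2 YN] := vosa_Y_trunc hA a b.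
pose D n m k := bop e a b n m k v - assoc a b n m k v.
suff : forall n m k, D n m k = 0 by move=> /(_ n m k)/subr0_eq.
have Drec n' m' k' : D n' (m' + 1) k' - D n' m' (k' + 1) = D (n' + 1) m' k'.
  by rewrite /D subr_swap bop_rec assoc_rec.
have D0 n' k' : D n' 0 k' = 0.
  rewrite /D bop_nprod // /assoc (@fsum1 _ _ _ 0%N).
    rewrite binz0 scale1r; apply/eqP; rewrite subr_eq0; apply/eqP.
    by congr (Y (Y _ _ _) _ _); lia.
  by case=> // j _; rewrite binz0n scale0r.
apply: (@intP1 _ (Num.max N1 N2)) => [n'|n' IH m' k'].
  rewrite ge_max => /andP[? ?] m' k'.
  by rewrite /D bopN // (@assoc_ord N2 0) ?big_ord0 ?subrr //; lia.
have step m2 k2 : D n' (m2 + 1) k2 = D n' m2 (k2 + 1).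
  by apply: subr0_eq; rewrite Drec IH.
have pos (i : nat) k2 : D n' i%:Z k2 = 0.
  elim: i k2 => [|i IHi] k2; first exact: D0.
  by rewrite (_ : i.+1%:Z = i%:Z + 1) ?step ?IHi //; lia.
have neg (i : nat) k2 : D n' (- i%:Z) k2 = 0.
  elim: i k2 => [|i IHi] k2; first exact: D0.
  have := step (- i.+1%:Z) (k2 - 1); rewrite subrK => <-.
  by rewrite (_ : - i.+1%:Z + 1 = - i%:Z) ?IHi //; lia.
case: (intP m') => [|i|i]; [exact: D0 | exact: pos | exact: neg].
Qed.

End Borcherds.

(** * Weights and modes *)

Section Weights.
Variables (R : realType) (V : lmodType R[i]) (A : vosa_data V).
Hypothesis hA : is_vosa A.
Local Notation C := R[i].
Local Notation Y := (nprod A).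
Local Notation T := (transl A).
Local Notation vac := (vac A).
Local Notation L := (L A).
Local Notation wt := (wt A).
Local Notation hcomp := (hcomp A).

(** The Borcherds identity for the conformal vector at exponent 0. As this vector is even no sign
    occurs, so the formula extends to [a] of mixed parity. *)
Lemma L_nprod_comm m a n v : L m (Y a n v) - Y a n (L m v) =
  \sum_(j \in [set: nat])
    binz C (m + 1) j *: Y (L (j%:Z - 1) a) (m + 1 + n - j%:Z) v.
Proof.
have H q b : par A q b -> L m (Y b n v) - Y b n (L m v) =
    assoc A (conf A) b 0 (m + 1) n v.
  move=> qb; rewrite -(borcherds_identity hA _ _ _ _ (vosa_conf_even hA) qb).
  by rewrite bop_zero /gcomm expr0 scale1r.
have assocD b c : assoc A (conf A) (b + c) 0 (m + 1) n v =
    assoc A (conf A) b 0 (m + 1) n v + assoc A (conf A) c 0 (m + 1) n v.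
  have supp x : fsupp (fun j : nat =>
      binz C (m + 1) j *: Y (Y (conf A) (0 + j%:Z) x) (m + 1 + n - j%:Z) v).
    have [K YK] := vosa_Y_trunc hA (conf A) x.
    apply: (@fsupp_nat _ _ `|K|%N) => j Kj.
    by rewrite YK ?(nprod0 hA) ?scaler0 //; lia.
  rewrite -[X in _ = X + _]scale1r -fsum_lin //; apply: eq_fsbigr => j _.
  by rewrite linearD (nprodD hA) scalerDr scale1r.
transitivity (assoc A (conf A) a 0 (m + 1) n v); last first.
  by apply: eq_fsbigr => j _; rewrite /L add0r subrK.
have [a0 [a1 [/H H0 /H H1 ->]]] := vosa_par_sum hA a.
by rewrite !(nprodD hA) linearD opprD addrACA H0 H1 assocD.
Qed.

Lemma nprod_transl a n v : Y (T a) n v = - n%:~R *: Y a (n - 1) v.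
Proof.
rewrite -(vosa_Y_transl hA) -!(vosa_L_transl hA) L_nprod_comm (@fsum1 _ _ _ 0%N).
  by rewrite binz0 scale1r; congr (Y (L _ _) _ _); lia.
by case=> // j _; rewrite binz0n scale0r.
Qed.

Lemma nprod_index_eq a n n' v : n = n' -> Y a n v = Y a n' v.
Proof. by move->. Qed.

Lemma L0_nprod a n v : L 0 (Y a n v) - Y a n (L 0 v) =
  Y (L 0 a) n v - (n + 1)%:~R *: Y a n v.
Proof.
rewrite L_nprod_comm add0r (@fsum_ord _ _ 2) => [|[|[|j]] //]; last first.
  by rewrite binz1n scale0r.
rewrite !big_ord_recr big_ord0 /= add0r binz0 binz1 !scale1r.
rewrite -[X in X + _]/(Y (L (-1) a) _ v) (vosa_L_transl hA) nprod_transl.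
rewrite -[X in _ + X]/(Y (L 0 a) _ v) addrC scaleNr.
by congr (_ - _ *: _); [|congr _%:~R|]; try apply: nprod_index_eq; lia.
Qed.

Lemma L1_nprod a n v : L 1 (Y a n v) - Y a n (L 1 v) =
  Y (L 1 a) n v + (Y (L 0 a) (n + 1) v *+ 2 - (n + 2)%:~R *: Y a (n + 1) v).
Proof.
rewrite L_nprod_comm -[1 + 1]/2 (@fsum_ord _ _ 3) => [|[|[|[|j]]] //]; last first.
  by rewrite binz2n scale0r.
rewrite !big_ord_recr big_ord0 /= add0r binz0 binz21 binz22 !scale1r.
rewrite -[X in X + _ + _]/(Y (L (-1) a) _ v) (vosa_L_transl hA) nprod_transl.
rewrite -[X in _ + X]/(Y (L 1 a) _ v) -[Y _ (2 + n - 1) v]/(Y (L 0 a) _ v).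
rewrite [LHS]addrC; congr (_ + _); first by apply: nprod_index_eq; lia.
rewrite [LHS]addrC scaleNr scaler_nat.
by congr (_ *+ 2 - _ *: _); [|congr _%:~R|]; try apply: nprod_index_eq; lia.
Qed.

Lemma wt_lin k (x : C) u v : wt k u -> wt k v -> wt k (x *: u + v).
Proof.
rewrite /Defs.wt /= => uk vk.
by rewrite linearD linearZ_LR uk vk scalerDr !scalerA mulrC.
Qed.

Lemma wt0v k : wt k 0.
Proof. by rewrite /Defs.wt /= linear0 scaler0. Qed.

Lemma wtZ k (x : C) u : wt k u -> wt k (x *: u).
Proof. by move=> uk; rewrite -[_ *: _]addr0; apply: wt_lin (wt0v k). Qed.

Lemma wt_eq k k' v : k = k' -> wt k v -> wt k' v.
Proof. by move->. Qed.

Lemma half_int (k : int) : (k * 2)%:~R / 2 = k%:~R :> C.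
Proof. by rewrite intrM mulfK // pnatr_eq0. Qed.

Lemma wt_nprod d e a b n : wt d a -> wt e b -> wt (d + e - 2 * n - 2) (Y a n b).
Proof.
rewrite /Defs.wt /= => ad be.
have := L0_nprod a n b; rewrite ad be (nprodZ hA) linearZ_LR => /eqP.
rewrite subr_eq => /eqP ->; rewrite -scalerBl -scalerDl; congr (_ *: _).
have -> : d + e - 2 * n - 2 = d + e - (n + 1) * 2 by lia.
by rewrite intrB mulrBl half_int; field.
Qed.

Lemma virasoro_L0 n v : n != 0 -> L 0 (L n v) - L n (L 0 v) = - n%:~R *: L n v.
Proof.
move=> n0; have [c ->] := vosa_virasoro hA.
by rewrite sub0r !add0r (negbTE n0) scale0r addr0 intrN.
Qed.

Lemma wt_L d n v : n != 0 -> wt d v -> wt (d - 2 * n) (L n v).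
Proof.
move=> n0; rewrite /Defs.wt /= => vd.
have := virasoro_L0 v n0; rewrite vd linearZ_LR => /eqP.
rewrite subr_eq => /eqP ->; rewrite -scalerDl; congr (_ *: _).
by rewrite (mulrC 2) intrB mulrBl half_int addrC.
Qed.

Lemma wt_L1 d v : wt d v -> wt (d - 2) (L 1 v).
Proof. exact: wt_L. Qed.

Lemma wt_transl d v : wt d v -> wt (d + 2) (T v).
Proof. by move=> vd; rewrite -(vosa_L_transl hA); apply: (@wt_L d (-1)). Qed.

Lemma wt_vac : wt 0 vac.
Proof. by rewrite /Defs.wt /= (nprod_vac_ge0 hA) // mul0r scale0r. Qed.

Lemma L1_vac : L 1 vac = 0.
Proof. exact: nprod_vac_ge0. Qed.

Lemma conf_L : L (-2) vac = conf A.
Proof. exact: (vosa_creation hA). Qed.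

Lemma wt_conf : wt 4 (conf A).
Proof. by rewrite -conf_L; apply: (@wt_L 0 (-2)) wt_vac. Qed.

Lemma L1_conf : L 1 (conf A) = 0.
Proof.
have [c vir] := vosa_virasoro hA; rewrite -conf_L.
have := vir 1 (-2) vac; rewrite L1_vac linear0 subr0 => ->.
rewrite -[1 + -2]/(-1 : int) (vosa_L_transl hA) (vosa_transl_vac hA).
by rewrite scaler0 add0r scale0r.
Qed.

Lemma L1_L0 v : L 1 (L 0 v) = L 0 (L 1 v) + L 1 v.
Proof.
have := @virasoro_L0 1 v isT; rewrite scaleN1r => /eqP.
by rewrite subr_eq addrC => /eqP ->; rewrite subrK.
Qed.

Lemma L1_T v : L 1 (T v) = T (L 1 v) + L 0 v *+ 2.
Proof.
have [c vir] := vosa_virasoro hA; have := vir 1 (-1) v.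
rewrite !(vosa_L_transl hA) subrr mulr0 scale0r addr0 => /eqP.
by rewrite subr_eq addrC => /eqP ->; rewrite -scaler_nat.
Qed.

(** Applying [L 0 - k0 / 2] removes the head of the list and multiplies every other summand by a
    nonzero scalar. *)
Lemma wt_independent (s : seq int) (f : int -> V) : uniq s ->
  (forall k, wt k (f k)) -> \sum_(k <- s) f k = 0 ->
  forall k, k \in s -> f k = 0.
Proof.
elim: s f => [//|k0 s IH] f /= /andP[k0s us] wf; rewrite big_cons => sum0.
have fs k : k \in s -> f k = 0.
  move=> ks; pose g k := ((k - k0)%:~R / 2 : C) *: f k.
  have : g k = 0.
    apply: IH ks => // [i|]; first exact: wtZ.
    have e : \sum_(j <- s) f j = - f k0 by apply/eqP; rewrite -addr_eq0 addrC sum0.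
    transitivity (L 0 (\sum_(j <- s) f j) -
                  (k0%:~R / 2 : C) *: \sum_(j <- s) f j).
      rewrite linear_sum scaler_sumr -sumrB; apply: eq_bigr => i _.
      by rewrite [L 0 _]wf -scalerBl /g intrB mulrBl.
    by rewrite e linearN /= [L 0 _]wf scalerN subrr.
  move/eqP; rewrite scaler_eq0 mulf_eq0 invr_eq0 pnatr_eq0 orbF intr_eq0 subr_eq0.
  by case/orP => [/eqP kk0|/eqP //]; rewrite -kk0 ks in k0s.
move=> k; rewrite inE => /orP[/eqP ->|/fs //].
by move: sum0; rewrite big_seq big1 ?addr0 // => i /fs.
Qed.

Lemma fsupp_hdecomp f v : hdecomp A f v -> fsupp f.
Proof.
case=> _ /finite_seqP[s fs] _; exists s => k; apply: contraNeq => fk.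
by have : [set k | f k != 0] k by []; rewrite fs.
Qed.

Lemma hdecomp_uniq f g v : hdecomp A f v -> hdecomp A g v -> f = g.
Proof.
move=> hf hg; apply: funext => k; apply: subr0_eq.
have [sf sg] := (fsupp_hdecomp hf, fsupp_hdecomp hg).
have [s h0] := fsupp_lin (-1) sg sf; have us := undup_uniq s.
have h0' i : i \notin undup s -> -1 *: g i + f i = 0 by rewrite mem_undup; apply: h0.
case: hf hg => wf _ vf [wg _ vg].
have : \sum_(i <- undup s) (-1 *: g i + f i) = 0.
  by rewrite -fsum_seq // fsum_lin // -vf -vg scaleN1r addNr.
have w i : wt i (-1 *: g i + f i) by apply: wt_lin.
move=> /(wt_independent us w) H; rewrite addrC -scaleN1r.
by have [/H //|/h0'] := boolP (k \in undup s).
Qed.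

Lemma hcompP v : hdecomp A (hcomp v) v.
Proof.
have [f hf] := vosa_L0_diag hA v.
exact: (@xgetPex _ (fun=> 0) [set f | hdecomp A f v] (ex_intro _ f hf)).
Qed.

Lemma hcompE f v : hdecomp A f v -> hcomp v = f.
Proof. exact/hdecomp_uniq/hcompP. Qed.

Lemma wt_hcomp v k : wt k (hcomp v k).
Proof. by case: (hcompP v). Qed.

Lemma fsupp_hcomp v : fsupp (hcomp v).
Proof. exact: fsupp_hdecomp (hcompP v). Qed.

Lemma sum_hcomp v : v = \sum_(k \in [set: int]) hcomp v k.
Proof. by case: (hcompP v). Qed.

Lemma fsupp_finite (f : int -> V) : fsupp f -> finite_set [set k | f k != 0].
Proof.
move=> [s fs]; apply: (@sub_finite_set _ _ [set` s]); last exact: finite_seq.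
by move=> k /= fk; apply: contraNT fk => /fs ->.
Qed.

Lemma hcomp_lin (x : C) u v k : hcomp (x *: u + v) k = x *: hcomp u k + hcomp v k.
Proof.
have [su sv] := (fsupp_hcomp u, fsupp_hcomp v).
suff -> : hcomp (x *: u + v) = fun k => x *: hcomp u k + hcomp v k by [].
apply: hcompE; split=> [i||].
- by apply: wt_lin; apply: wt_hcomp.
- exact/fsupp_finite/fsupp_lin.
- by rewrite fsum_lin // -!sum_hcomp.
Qed.

Lemma hdecomp_wt d v : wt d v -> hdecomp A (fun k => if k == d then v else 0) v.
Proof.
move=> vd; split=> [k||].
- by case: eqP => [->|_] //; exact: wt0v.
- by apply: fsupp_finite; exists [:: d] => i; rewrite inE; case: eqP.
- by rewrite (@fsum1 _ _ _ d) ?eqxx // => i /negbTE ->.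
Qed.

Lemma hcomp_wt d v : wt d v -> hcomp v = fun k => if k == d then v else 0.
Proof. by move/hdecomp_wt/hcompE. Qed.

Lemma homogeneous_ind (P : V -> Prop) :
  (forall u v, P u -> P v -> P (u + v)) -> (forall d v, wt d v -> P v) ->
  forall v, P v.
Proof.
move=> PD Pwt v; have [s hs] := fsupp_hcomp v.
have hs' k : k \notin undup s -> hcomp v k = 0 by rewrite mem_undup; apply: hs.
rewrite [v]sum_hcomp (fsum_seq (undup_uniq s) hs').
elim: (undup s) => [|k t IH]; first by rewrite big_nil; apply/Pwt/(wt0v 0).
by rewrite big_cons; apply: PD IH; apply/Pwt/wt_hcomp.
Qed.

Lemma par_wt d v : wt d v -> par A (odd `|d|%N) v.
Proof.
move=> vd; rewrite (vosa_par_wt hA); exists (fun k => if k == d then v else 0).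
split=> [|k]; first exact: hdecomp_wt.
by case: (k =P d) => [->|_ /eqP].
Qed.

(* Maps of the form [a |-> \sum_d g d (a_d)], such as [mode] and [sgnL0]. *)
Section ComponentSums.
Variable g : int -> V -> V.
Hypothesis g_lin : forall d x u v, g d (x *: u + v) = x *: g d u + g d v.

Lemma hsum_fsupp a : fsupp (fun d => g d (hcomp a d)).
Proof.
have [s hs] := fsupp_hcomp a; exists s => d /hs ->.
have := g_lin d (-1) 0 0; rewrite scaler0 addr0 => ->.
by rewrite scaleN1r addNr.
Qed.

Lemma hsum_lin (x : C) u v :
  \sum_(d \in [set: int]) g d (hcomp (x *: u + v) d) =
  x *: \sum_(d \in [set: int]) g d (hcomp u d) +
  \sum_(d \in [set: int]) g d (hcomp v d).
Proof.
rewrite -fsum_lin; try exact: hsum_fsupp.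
by apply: eq_fsbigr => d _; rewrite hcomp_lin g_lin.
Qed.

Lemma hsum_wt d a : wt d a ->
  \sum_(k \in [set: int]) g k (hcomp a k) = g d a.
Proof.
move=> ad; rewrite (hcomp_wt ad) (@fsum1 _ _ _ d) ?eqxx // => k /negbTE ->.
have := g_lin k (-1) 0 0; rewrite scaler0 addr0 => ->.
by rewrite scaleN1r addNr.
Qed.

End ComponentSums.

End Weights.

(** * Modes, signs and the exponential of [L_1] *)

Section Modes.
Variables (R : realType) (V : lmodType R[i]) (A : vosa_data V).
Hypothesis hA : is_vosa A.
Local Notation C := R[i].
Local Notation Y := (nprod A).
Local Notation T := (transl A).
Local Notation vac := (vac A).
Local Notation L := (L A).
Local Notation wt := (wt A).
Local Notation hcomp := (hcomp A).
Local Notation mode := (mode A).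
Local Notation sgnL0 := (sgnL0 A).
Local Notation expL1 := (expL1 A).

Lemma mode_summand_lin k b d (x : C) u v :
  (if (2 %| k + d)%Z then Y (x *: u + v) (((k + d) %/ 2)%Z - 1) b else 0) =
  x *: (if (2 %| k + d)%Z then Y u (((k + d) %/ 2)%Z - 1) b else 0) +
  (if (2 %| k + d)%Z then Y v (((k + d) %/ 2)%Z - 1) b else 0).
Proof.
by case: ifP => _; rewrite ?scaler0 ?addr0 // (nprodD hA) (nprodZ hA).
Qed.

Lemma mode_lin (x : C) u v k b : mode (x *: u + v) k b = x *: mode u k b + mode v k b.
Proof.
exact: (@hsum_lin _ _ _ hA (fun d u =>
  if (2 %| k + d)%Z then Y u (((k + d) %/ 2)%Z - 1) b else 0)
  (mode_summand_lin k b)).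
Qed.

Lemma modeD u v k b : mode (u + v) k b = mode u k b + mode v k b.
Proof. by rewrite -{1}[u]scale1r mode_lin scale1r. Qed.

Lemma mode0 k b : mode 0 k b = 0.
Proof.
by rewrite -[RHS](addNr (mode 0 k b)) -scaleN1r -mode_lin scaler0 addr0.
Qed.

Lemma modeZ (x : C) u k b : mode (x *: u) k b = x *: mode u k b.
Proof. by rewrite -[x *: u]addr0 mode_lin mode0 addr0. Qed.

Lemma mode_sum (I : Type) (s : seq I) (F : I -> V) k b :
  mode (\sum_(i <- s) F i) k b = \sum_(i <- s) mode (F i) k b.
Proof.
elim: s => [|i s IH]; first by rewrite !big_nil mode0.
by rewrite !big_cons modeD IH.
Qed.

Lemma mode_wt d a k b : wt d a -> mode a k b =
  if (2 %| k + d)%Z then Y a (((k + d) %/ 2)%Z - 1) b else 0.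
Proof.
move=> ad; exact: (@hsum_wt _ _ _ hA (fun d u =>
  if (2 %| k + d)%Z then Y u (((k + d) %/ 2)%Z - 1) b else 0)
  (mode_summand_lin k b)).
Qed.

Lemma mode_even d a n k b : wt d a -> k = (n + 1) * 2 - d -> mode a k b = Y a n b.
Proof.
move=> ad kE; rewrite (mode_wt _ _ ad) (_ : k + d = (n + 1) * 2); last lia.
by rewrite dvdz_mull // mulzK // addrK.
Qed.

Lemma mode_odd d a k b : wt d a -> (forall n, k <> (n + 1) * 2 - d) ->
  mode a k b = 0.
Proof.
move=> ad kn; rewrite (mode_wt _ _ ad); case: ifP => // /dvdzP[q qE].
by case: (kn (q - 1)); lia.
Qed.

Lemma index_parity (d k : int) :
  (exists n, k = (n + 1) * 2 - d) \/ (forall n, k <> (n + 1) * 2 - d).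
Proof.
have [/dvdzP[q qE]|nd] := boolP (2 %| k + d)%Z.
  by left; exists (q - 1); lia.
right=> n kE; case/negP: nd; rewrite kE subrK; exact: dvdz_mull.
Qed.

Lemma L0_wt d a : wt d a -> L 0 a = (d%:~R / 2 : C) *: a.
Proof. by []. Qed.

Lemma wt_L0 d a : wt d a -> wt d (L 0 a).
Proof. by move=> ad; rewrite (L0_wt ad); apply: wtZ. Qed.

Lemma half_index (n d : int) : ((n + 1) * 2 - d)%:~R / 2 = (n + 1)%:~R - d%:~R / 2 :> C.
Proof. by rewrite intrB mulrBl half_int. Qed.

(** Here and in the next two commutators [L 0 a] takes the place of the weight of [a]. The formulas
    thus apply to inhomogeneous vectors such as [bar a] and can be compared after taking
    adjoints. *)
Lemma mode_transl a k v :
  mode (T a) k v = - (k%:~R / 2 : C) *: mode a k v - mode (L 0 a) k v.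
Proof.
elim/(homogeneous_ind hA): a => [a b IHa IHb|d a ad].
  by rewrite !linearD !modeD IHa IHb scalerDr opprD addrACA.
have wTa := wt_transl hA ad; rewrite (L0_wt ad) modeZ.
have [[n kE]|kn] := index_parity d k.
  rewrite (mode_even (n := n + 1) _ wTa) ?(mode_even _ ad kE); last lia.
  rewrite (nprod_transl hA) addrK -scalerBl kE half_index; congr (_ *: _); ring.
rewrite (mode_odd _ wTa) ?(mode_odd _ ad kn) ?scaler0 ?subrr // => n kE.
by case: (kn (n - 1)); lia.
Qed.

Lemma L1_mode a k v : L 1 (mode a k v) - mode a k (L 1 v) =
  mode (L 1 a) (k + 2) v + mode (L 0 a) (k + 2) v
  - (1 + k%:~R / 2 : C) *: mode a (k + 2) v.
Proof.
elim/(homogeneous_ind hA): a => [a b IHa IHb|d a ad].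
  rewrite !modeD !(linearD (L 1)) (linearD (L 0)) !modeD opprD addrACA IHa IHb.
  by rewrite scalerDr opprD [in LHS]addrACA; congr (_ + _); rewrite addrACA.
have wL1 := wt_L1 hA ad; rewrite (L0_wt ad) modeZ.
have [[n kE]|kn] := index_parity d k.
  rewrite (mode_even (n := n) _ wL1) ?(mode_even (k := k + 2) (n := n + 1) _ ad);
    try lia.
  rewrite !(mode_even _ ad kE) (L1_nprod hA) (L0_wt ad) (nprodZ hA).
  rewrite -scaler_nat scalerA -addrA -!scalerBl kE half_index.
  by congr (_ + _ *: _); field.
rewrite (mode_odd _ wL1) ?(mode_odd (k := k + 2) _ ad) ?(mode_odd _ ad kn).
- by rewrite !scaler0 linear0 !subr0 addr0.
- by move=> n kE; case: (kn (n - 1)); lia.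
- by move=> n kE; case: (kn n); lia.
Qed.

Lemma T_mode a k v : T (mode a k v) - mode a k (T v) =
  (1 - k%:~R / 2 : C) *: mode a (k - 2) v - mode (L 0 a) (k - 2) v.
Proof.
elim/(homogeneous_ind hA): a => [a b IHa IHb|d a ad].
  rewrite !modeD (linearD T) (linearD (L 0)) !modeD opprD addrACA IHa IHb.
  by rewrite scalerDr [in LHS]addrACA -opprD.
rewrite (L0_wt ad) modeZ -scalerBl.
have [[n kE]|kn] := index_parity d k.
  rewrite !(mode_even _ ad kE) (mode_even (n := n - 1) _ ad); last lia.
  rewrite (vosa_Y_transl hA) kE half_index; congr (_ *: _); ring.
rewrite (mode_odd (k := k - 2) _ ad) ?(mode_odd _ ad kn).
- by rewrite linear0 scaler0 subr0.
- by move=> n kE; case: (kn (n + 1)); lia.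
Qed.

Lemma mode_conf n v : mode (conf A) (n * 2) v = L n v.
Proof. by rewrite (mode_even (n := n + 1) _ (wt_conf hA)) //; lia. Qed.

Lemma mode_vac k v : mode vac k v = if k == 0 then v else 0.
Proof.
have [[n kE]|kn] := index_parity 0 k.
  rewrite (mode_even _ (wt_vac hA) kE) (vosa_Y_vac hA) kE.
  by congr (if _ then _ else _); apply/eqP/eqP; lia.
rewrite (mode_odd _ (wt_vac hA) kn); case: eqP => // k0.
by case: (kn (-1)); lia.
Qed.

(** If all components below [d] vanish, [mode a (- d) vac] is the component at [d]: higher
    components enter through products of nonnegative index, which kill the vacuum. *)
Lemma mode_vac_eq0 a : (forall k, mode a k vac = 0) -> a = 0.
Proof.
move=> a0; have [K wK] := vosa_wt_bounded hA.
suff H (j : nat) : forall d : int, d < K + j%:Z -> hcomp a d = 0.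
  rewrite (sum_hcomp hA a); apply: fsbig1 => d _.
  by rewrite (H (absz ((d : int) + 1 - K)%R) d) //; lia.
elim: j => [|j IH] d.
  rewrite addr0 => /wK wd0; have := wt_hcomp hA a d.
  by rewrite wd0.
move=> dj; have [/IH //|jd] := ltP d (K + j%:Z).
have := a0 (- d); rewrite /Defs.mode (@fsum1 _ _ _ d).
  by rewrite addNr dvdz0 div0z sub0r (vosa_creation hA).
move=> i id; case: ifP => // /dvdzP[q qE].
have [ilt|dle] := ltP i d; first by rewrite IH ?(nprod0 hA) //; lia.
by rewrite (nprod_vac_ge0 hA) // qE mulzK //; move/eqP: id => id; lia.
Qed.

Lemma mode_inj a b : (forall k v, mode a k v = mode b k v) -> a = b.
Proof.
move=> ab; apply: subr0_eq; rewrite addrC -scaleN1r.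
by apply: mode_vac_eq0 => k; rewrite mode_lin ab scaleN1r addNr.
Qed.

(** The eigenvalue of [(-1)^(2 L_0^2 + L_0)] on [V_(k/2)]; for [k = 0, 1, 2, 3] modulo 4 it is
    [1, -1, -1, 1]. *)
Definition sgn (k : int) : C := (-1) ^ (k * (k + 1) %/ 2)%Z.

Lemma signzD (x y : int) : (-1) ^ (x + y) = (-1) ^ x * (-1) ^ y :> C.
Proof. by rewrite expfzDr // oppr_eq0 oner_eq0. Qed.

Lemma signz_sq (x : int) : (-1) ^ x * (-1) ^ x = 1 :> C.
Proof.
case: x => n; first by rewrite -exprnP -expr2 sqrr_sign.
by rewrite NegzE -exprnN -invfM -expr2 sqrr_sign invr1.
Qed.

Lemma signz_even (x : int) : (-1) ^ (x * 2) = 1 :> C.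
Proof. by rewrite -[2]/(1 + 1) mulrDr mulr1 signzD signz_sq. Qed.

Lemma sgn_even q : sgn (q * 2) = (-1) ^ q.
Proof.
rewrite /sgn (_ : q * 2 * (q * 2 + 1) = (q * q * 2 + q) * 2); last by ring.
by rewrite mulzK // signzD signz_even mul1r.
Qed.

Lemma sgn_odd q : sgn (q * 2 + 1) = - (-1) ^ q.
Proof.
rewrite /sgn (_ : _ * _ = ((q * q + q) * 2 + q + 1) * 2); last by ring.
by rewrite mulzK // signzS signzD signz_even mul1r.
Qed.

Lemma int_parity (k : int) : exists q : int, k = q * 2 \/ k = q * 2 + 1.
Proof. by exists (k %/ 2)%Z; lia. Qed.

Lemma sgn_sq k : sgn k * sgn k = 1.
Proof. exact: signz_sq. Qed.

Lemma sgn_shift k n : sgn (k - n * 2) = (-1) ^ n * sgn k.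
Proof.
have sN : (-1) ^ (- n) = (-1) ^ n :> C.
  by rewrite -[LHS]mulr1 -[X in _ * X](signz_sq n) mulrA -signzD addNr expr0z mul1r.
have [q [->|->]] := int_parity k.
  by rewrite -mulrBl !sgn_even signzD sN mulrC.
rewrite addrAC -mulrBl !sgn_odd signzD sN mulrN; congr (- _); exact: mulrC.
Qed.

Lemma sgn_sub2 k : sgn (k - 2) = - sgn k.
Proof. by rewrite -[2]mul1r sgn_shift expr1z mulN1r. Qed.

Lemma sgn_add2 k : sgn (k + 2) = - sgn k.
Proof. by rewrite -[in RHS](addrK 2 k) sgn_sub2 opprK. Qed.

Lemma sgn_conj k : (sgn k)^* = sgn k.
Proof. by apply: conj_Creal; rewrite rpredXz // rpredN rpred1. Qed.

(** Multiplicativity fails by the Koszul sign of two odd vectors, the same sign as in graded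
    locality. *)
Lemma sgnD d e :
  sgn (d + e) = (-1) ^+ (odd `|d|%N && odd `|e|%N) * (sgn d * sgn e).
Proof.
have [q [->|->]] := int_parity d; have [r [->|->]] := int_parity e.
- rewrite (_ : odd _ && _ = false) ?expr0 ?mul1r; last lia.
  by rewrite -mulrDl !sgn_even signzD.
- rewrite (_ : odd _ && _ = false) ?expr0 ?mul1r; last lia.
  by rewrite addrA -mulrDl !sgn_even !sgn_odd signzD mulrN.
- rewrite (_ : odd _ && _ = false) ?expr0 ?mul1r; last lia.
  by rewrite addrAC -mulrDl !sgn_even !sgn_odd signzD mulNr.
- rewrite (_ : odd _ && _ = true) ?expr1 ?mulN1r; last lia.
  rewrite (_ : q * 2 + 1 + (r * 2 + 1) = (q + r + 1) * 2); last by ring.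
  by rewrite sgn_even !sgn_odd signzS signzD mulrNN.
Qed.

Lemma sgnL0_summand_lin d (x : C) u v :
  sgn d *: (x *: u + v) = x *: (sgn d *: u) + sgn d *: v :> V.
Proof. by rewrite scalerDr !scalerA mulrC. Qed.

Lemma sgnL0_lin (x : C) u v : sgnL0 (x *: u + v) = x *: sgnL0 u + sgnL0 v.
Proof. exact: (hsum_lin hA sgnL0_summand_lin). Qed.

Lemma sgnL0_wt d a : wt d a -> sgnL0 a = sgn d *: a.
Proof. exact: (hsum_wt hA sgnL0_summand_lin). Qed.

Lemma iter_L1_lin j (x : C) u v :
  iter j (L 1) (x *: u + v) = x *: iter j (L 1) u + iter j (L 1) v.
Proof. by elim: j => //= j ->; rewrite linearP. Qed.

Lemma wt_iter_L1 d a j : wt d a -> wt (d - j%:Z * 2) (iter j (L 1) a).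
Proof.
move=> ad; elim: j => [|j IH]; first by rewrite mul0r subr0.
by apply: wt_eq (wt_L1 hA IH); lia.
Qed.

Lemma L1_nilpotent a : exists N : nat, forall j, (N <= j)%N -> iter j (L 1) a = 0.
Proof.
elim/(homogeneous_ind hA): a => [u v [N HN] [M HM]|d a ad].
  exists (maxn N M) => j; rewrite geq_max => /andP[/HN uj /HM vj].
  by rewrite -[u]scale1r iter_L1_lin uj vj scaler0 addr0.
have [K wK] := vosa_wt_bounded hA; exists (absz (d + 1 - K)%R) => j dj.
by have := wt_iter_L1 j ad; rewrite wK //; lia.
Qed.

Lemma iter_L1_scale j (x : C) u : iter j (L 1) (x *: u) = x *: iter j (L 1) u.
Proof. by elim: j => //= j ->; rewrite linearZ. Qed.

Lemma iter_L1_0 j : iter j (L 1) 0 = 0.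
Proof. by elim: j => //= j ->; rewrite linear0. Qed.

Lemma fsupp_L1 (f : nat -> C) a : fsupp (fun j => f j *: iter j (L 1) a).
Proof.
have [N HN] := L1_nilpotent a.
by apply: (@fsupp_nat _ _ N) => j /HN ->; rewrite scaler0.
Qed.

Lemma expL1_lin (x : C) u v : expL1 (x *: u + v) = x *: expL1 u + expL1 v.
Proof.
rewrite -fsum_lin; try exact: fsupp_L1.
apply: eq_fsbigr => j _.
by rewrite iter_L1_lin scalerDr !scalerA mulrC.
Qed.

Lemma expL1_ord a N : (forall j, (N <= j)%N -> iter j (L 1) a = 0) ->
  expL1 a = \sum_(j < N) (j`!%:R^-1 : C) *: iter j (L 1) a.
Proof. by move=> aN; apply: fsum_ord => j /aN ->; rewrite scaler0. Qed.

Lemma expL1_kernel a : L 1 a = 0 -> expL1 a = a.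
Proof.
move=> La; rewrite (@expL1_ord _ 1) => [|[|j] // _].
  by rewrite big_ord1 fact0 invr1 scale1r.
by rewrite iterSr La iter_L1_0.
Qed.

Lemma expL1_L1 a : expL1 (L 1 a) = L 1 (expL1 a).
Proof.
rewrite (fsum_linear (L 1)); last exact: fsupp_L1.
by apply: eq_fsbigr => j _; rewrite linearZ_LR -iterSr.
Qed.

Lemma factV_S j : (j.+1%:R * (j.+1)`!%:R^-1 : C) = j`!%:R^-1.
Proof.
by rewrite factS natrM invfM mulrA mulfV ?mul1r // pnatr_eq0.
Qed.

Lemma L1_expL1 a : L 1 (expL1 a) =
  \sum_(j \in [set: nat]) (j%:R / j`!%:R : C) *: iter j (L 1) a.
Proof.
have [N HN] := L1_nilpotent a.
rewrite (expL1_ord HN) (@fsum_ord _ _ N.+1) => [|j Nj]; last first.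
  by rewrite HN ?scaler0 // ltnW.
rewrite big_ord_recl /= mul0r scale0r add0r linear_sum /=.
by apply: eq_bigr => j _; rewrite linearZ_LR /bump add1n factV_S.
Qed.

Lemma iter_L1_L0 j a :
  iter j (L 1) (L 0 a) = L 0 (iter j (L 1) a) + j%:R *: iter j (L 1) a.
Proof.
elim: j => [|j IH]; first by rewrite /= scale0r addr0.
rewrite iterS IH linearD /= (L1_L0 hA) linearZ_LR -addrA.
by rewrite -[X in X + j%:R *: _]scale1r -scalerDl nat1r.
Qed.

Lemma expL1_L0 a : expL1 (L 0 a) = L 0 (expL1 a) + L 1 (expL1 a).
Proof.
rewrite L1_expL1 (fsum_linear (L 0)); last exact: fsupp_L1.
rewrite -[X in X + _]scale1r -fsum_lin; last exact: fsupp_L1; last first.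
  have [s Hs] := fsupp_L1 (fun j => j`!%:R^-1) a.
  by exists s => j /Hs ->; rewrite linear0.
apply: eq_fsbigr => j _.
by rewrite iter_L1_L0 scalerDr scale1r [L 0 (_ *: _)]linearZ_LR scalerA mulrC.
Qed.

(** Each [L 1] is moved past [T] by the sl(2) relations [[L_1, T] = 2 L_0] and [[L_1, L_0] =
    L_1]. *)
Lemma iter_L1_T j a : iter j.+1 (L 1) (T a) =
  T (iter j.+1 (L 1) a) + (2 * j.+1)%:R *: L 0 (iter j (L 1) a) +
  (j.+1 * j)%:R *: iter j (L 1) a.
Proof.
elim: j => [|j IH].
  by rewrite /= (L1_T hA) muln0 scale0r addr0 muln1 scaler_nat.
rewrite iterS IH !linearD /= (L1_T hA) !linearZ_LR (L1_L0 hA) /=.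
rewrite -scaler_nat scalerDr -!addrA; congr (_ + _).
rewrite addrA -scalerDl -scalerDl -!natrD.
by congr (_%:R *: _ + _%:R *: _); lia.
Qed.

(** Conjugation by [e^(L_1)] sends [T] to [T + 2 L_0 + L_1]: divided by [(j + 1)!], the three terms
    of [iter_L1_T] sum to these three. *)
Lemma expL1_T a :
  expL1 (T a) = T (expL1 a) + L 0 (expL1 a) *+ 2 + L 1 (expL1 a).
Proof.
have [N HN] := L1_nilpotent a.
have TN j : (N.+1 <= j)%N -> iter j (L 1) (T a) = 0.
  case: j => // j Nj; rewrite iter_L1_T !HN //; last exact: ltnW.
  by rewrite !linear0 ?scaler0 !addr0.
rewrite (expL1_ord TN) big_ord_recl fact0 invr1 scale1r.
under eq_bigr => j _ do rewrite lift0 iter_L1_T !scalerDr.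
rewrite !big_split /= -scaler_nat !addrA; congr (_ + _ + _).
- rewrite (@expL1_ord _ N.+1) => [|j Nj]; last by rewrite HN // ltnW.
  rewrite [in RHS]big_ord_recl fact0 invr1 scale1r linearD linear_sum.
  by congr (_ + _); apply: eq_bigr => j _; rewrite lift0 [in RHS]linearZ_LR.
- rewrite (expL1_ord HN) linear_sum scaler_sumr.
  apply: eq_bigr => j _; rewrite [L 0 (_ *: _)]linearZ_LR !scalerA.
  by rewrite [X in X *: _ = _]mulrC natrM -mulrA factV_S.
- rewrite L1_expL1 (@fsum_ord _ _ N) => [|j /HN ->]; last by rewrite scaler0.
  by apply: eq_bigr => j _; rewrite scalerA natrM mulrA [_^-1 * _]mulrC factV_S mulrC.
Qed.

End Modes.

(** * The operator [E] and the series of the invariance axiom *)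

Section ExpSign.
Variables (R : realType) (V : lmodType R[i]) (A : vosa_data V).
Hypothesis hA : is_vosa A.
Local Notation C := R[i].
Local Notation Y := (nprod A).
Local Notation T := (transl A).
Local Notation vac := (vac A).
Local Notation L := (L A).
Local Notation wt := (wt A).
Local Notation hcomp := (hcomp A).
Local Notation mode := (mode A).
Local Notation sgnL0 := (sgnL0 A).
Local Notation expL1 := (expL1 A).
Local Notation sgn := (sgn R).

Lemma sgnL0D u v : sgnL0 (u + v) = sgnL0 u + sgnL0 v.
Proof. by have := sgnL0_lin hA 1 u v; rewrite !scale1r. Qed.

Lemma sgnL0_L0 a : sgnL0 (L 0 a) = L 0 (sgnL0 a).
Proof.
elim/(homogeneous_ind hA): a => [u v IHu IHv|d a ad].
  by rewrite (linearD (L 0)) !sgnL0D IHu IHv linearD.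
by rewrite (sgnL0_wt hA (wt_L0 ad)) (sgnL0_wt hA ad) linearZ_LR.
Qed.

Lemma sgnL0_L1 a : sgnL0 (L 1 a) = - L 1 (sgnL0 a).
Proof.
elim/(homogeneous_ind hA): a => [u v IHu IHv|d a ad].
  by rewrite (linearD (L 1)) !sgnL0D IHu IHv (linearD (L 1)) opprD.
rewrite (sgnL0_wt hA (wt_L1 hA ad)) (sgnL0_wt hA ad) linearZ_LR.
by rewrite sgn_sub2 scaleNr.
Qed.

Lemma sgnL0_T a : sgnL0 (T a) = - T (sgnL0 a).
Proof.
elim/(homogeneous_ind hA): a => [u v IHu IHv|d a ad].
  by rewrite (linearD T) !sgnL0D IHu IHv (linearD T) opprD.
rewrite (sgnL0_wt hA (wt_transl hA ad)) (sgnL0_wt hA ad) linearZ_LR.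
by rewrite sgn_add2 scaleNr.
Qed.

(** The operator [E] that relates [theta] and the involution in both directions. *)
Definition expsgn (a : V) : V := expL1 (sgnL0 a).

Lemma expsgn_lin (x : C) u v : expsgn (x *: u + v) = x *: expsgn u + expsgn v.
Proof. by rewrite /expsgn (sgnL0_lin hA) (expL1_lin hA). Qed.

Lemma expsgnD u v : expsgn (u + v) = expsgn u + expsgn v.
Proof. by have := expsgn_lin 1 u v; rewrite !scale1r. Qed.

Lemma expsgn0 : expsgn 0 = 0.
Proof. by rewrite -[RHS](addNr (expsgn 0)) -scaleN1r -expsgn_lin scaler0 addr0. Qed.

Lemma expsgnZ (x : C) u : expsgn (x *: u) = x *: expsgn u.
Proof. by have := expsgn_lin x u 0; rewrite expsgn0 !addr0. Qed.

Lemma expsgnN u : expsgn (- u) = - expsgn u.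
Proof. by rewrite -scaleN1r expsgnZ scaleN1r. Qed.

Lemma expL1N u : expL1 (- u) = - expL1 u.
Proof.
have e0 : expL1 0 = 0 by rewrite expL1_kernel // linear0.
by have := expL1_lin hA (-1) u 0; rewrite e0 !addr0 !scaleN1r.
Qed.

(** The relations of [E] with [L_0], [L_1] and [T] have the same form as those of [bar] below, so
    the corrections cancel in [E bar]. *)
Lemma expsgn_L0 a : expsgn (L 0 a) = L 0 (expsgn a) + L 1 (expsgn a).
Proof. by rewrite /expsgn sgnL0_L0 (expL1_L0 hA). Qed.

Lemma expsgn_L1 a : expsgn (L 1 a) = - L 1 (expsgn a).
Proof. by rewrite /expsgn sgnL0_L1 expL1N (expL1_L1 hA). Qed.

Lemma expsgn_T a :
  expsgn (T a) = - (T (expsgn a) + L 0 (expsgn a) *+ 2 + L 1 (expsgn a)).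
Proof. by rewrite /expsgn sgnL0_T expL1N (expL1_T hA). Qed.

Lemma expsgn_primary d a : wt d a -> L 1 a = 0 -> expsgn a = sgn d *: a.
Proof.
move=> ad La; rewrite /expsgn (sgnL0_wt hA ad) expL1_kernel //.
by rewrite linearZ_LR La scaler0.
Qed.

Lemma expsgn_vac : expsgn vac = vac.
Proof.
rewrite (expsgn_primary (wt_vac hA) (L1_vac hA)).
by rewrite -[0](mul0r 2) sgn_even expr0z scale1r.
Qed.

Lemma expsgn_conf : expsgn (conf A) = conf A.
Proof.
rewrite (expsgn_primary (wt_conf hA) (L1_conf hA)).
by rewrite -[4]/(2 * 2 : int) sgn_even -[2]/(1 * 2 : int) signz_even scale1r.
Qed.

Lemma expsgn_wt d a : wt d a ->
  expsgn a = \sum_(j \in [set: nat]) (sgn d / j`!%:R) *: iter j (L 1) a.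
Proof.
move=> ad; rewrite /expsgn (sgnL0_wt hA ad); apply: eq_fsbigr => j _.
by rewrite iter_L1_scale scalerA mulrC.
Qed.

(* The filtration by [\bigoplus_(k < d) V_(k/2)]. *)
Definition low (d : int) : set V := [set v |
  forall S : set V, is_subspace S -> (forall k, k < d -> wt k `<=` S) -> S v].

Lemma low_subspace d : is_subspace (low d).
Proof.
split=> [S [] //|x u v lu lv S SS Sd].
by case: (SS) => _; apply; [exact: lu | exact: lv].
Qed.

Lemma low_lin d (x : C) u v : low d u -> low d v -> low d (x *: u + v).
Proof. by case: (low_subspace d) => _; apply. Qed.

Lemma low_wt d k v : k < d -> wt k v -> low d v.
Proof. by move=> kd vk S _ /(_ k kd v vk). Qed.

Lemma low_sum d (I : Type) (s : seq I) (F : I -> V) :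
  (forall i, low d (F i)) -> low d (\sum_(i <- s) F i).
Proof.
move=> lF; elim/big_rec: _ => [|i v _ lv]; first by case: (low_subspace d).
by rewrite -[F i]scale1r; apply: low_lin.
Qed.

(** The vectors with zero component at [d] form a subspace that contains every lower eigenspace,
    hence all of [low d]. *)
Lemma low_disjoint d v : low d v -> wt d v -> v = 0.
Proof.
move=> lv vd; have : [set v | hcomp v d = 0] v.
  apply: lv => [|k kd u /(hcomp_wt hA) uk /=].
    split=> [|x u w /= u0 w0]; last by rewrite (hcomp_lin hA) u0 w0 scaler0 addr0.
    by rewrite /= (hcomp_wt hA (wt0v A d)) eqxx.
  by rewrite uk; case: eqP => // kd'; move: kd; rewrite kd' ltxx.
by rewrite /= (hcomp_wt hA vd) eqxx.
Qed.

Lemma expsgn_unitriangular d a : wt d a -> low d (expsgn a - sgn d *: a).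
Proof.
move=> ad; have [N HN] := L1_nilpotent hA a.
rewrite (expsgn_wt ad) (@fsum_ord _ _ N.+1) => [|j Nj]; last first.
  by rewrite HN ?scaler0 // ltnW.
rewrite big_ord_recl fact0 divr1 addrAC subrr add0r.
apply: low_sum => j; rewrite lift0.
apply: (@low_wt _ (d - j.+1%:Z * 2)); first by lia.
exact/wtZ/(wt_iter_L1 hA).
Qed.

Lemma expsgn_low d v : low d v -> low d (expsgn v).
Proof.
move=> lv; apply: (lv [set v | low d (expsgn v)]) => [|k kd u uk /=].
  split=> [|x u w /= lu lw]; first by rewrite /= expsgn0; case: (low_subspace d).
  by rewrite expsgn_lin; apply: low_lin.
rewrite -(subrK (sgn k *: u) (expsgn u)) -[expsgn u - _]scale1r; apply: low_lin.
  move=> S SS Sd; apply: (expsgn_unitriangular uk) => // k' k'k.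
  by apply: Sd; exact: lt_trans k'k kd.
by apply: (low_wt kd); apply: wtZ.
Qed.

(* [expsgn \o expsgn] commutes with [L 0] and is unitriangular for the
   filtration [low]. *)
Lemma expsgnK : involutive expsgn.
Proof.
move=> a; elim/(homogeneous_ind hA): a => [u v IHu IHv|d a ad].
  by rewrite !expsgnD IHu IHv.
apply: subr0_eq; apply: (@low_disjoint d).
  rewrite -{1}(subrK (sgn d *: a) (expsgn a)) expsgnD expsgnZ.
  rewrite -addrA -[expsgn (_ - _)]scale1r; apply: low_lin.
    by apply: expsgn_low; apply: expsgn_unitriangular.
  rewrite (_ : _ - a = sgn d *: (expsgn a - sgn d *: a) + 0); last first.
    by rewrite addr0 scalerBr scalerA sgn_sq scale1r.
  by apply: low_lin; [exact: expsgn_unitriangular | case: (low_subspace d)].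
rewrite addrC -scaleN1r; apply: wt_lin => //.
rewrite /Defs.wt /= -expsgnZ -expsgnZ -(L0_wt ad) expsgn_L0 expsgnD.
by rewrite expsgn_L0 expsgn_L1 addrK.
Qed.

(* e^(z L_1) (-1)^(2 L_0^2 + L_0) z^(-2 L_0) a, as in the invariance axiom. *)
Definition opp_series (a : V) : int -> V :=
  expzL1 A (fun i => sgnL0 (zpowL0 A a i)).

Lemma opp_summand_fsupp a i : fsupp (fun j : nat =>
  (j`!%:R^-1 : C) *: iter j (L 1) (sgnL0 (zpowL0 A a (i - j%:Z)))).
Proof.
have [s Hs] := fsupp_hcomp hA a; exists [seq absz (k + i)%R | k <- s] => j js.
rewrite /zpowL0 Hs; last first.
  by apply: contra js => H; apply/mapP; exists (- (i - j%:Z)); [exact: H|lia].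
rewrite (sgnL0_wt hA (wt0v A 0)) scaler0 (_ : iter _ _ 0 = 0) ?scaler0 //.
exact: iter_L1_0.
Qed.

Lemma opp_series_lin (x : C) u v i :
  opp_series (x *: u + v) i = x *: opp_series u i + opp_series v i.
Proof.
rewrite -fsum_lin; try exact: opp_summand_fsupp.
apply: eq_fsbigr => j _.
rewrite /zpowL0 (hcomp_lin hA) (sgnL0_lin hA) iter_L1_lin.
by rewrite scalerDr !scalerA mulrC.
Qed.

(** [z^(-2 L_0)] places [a] in degree [- d], so degree [i] is reached only by the term [j = i + d]
    of [e^(z L_1)]. *)
Lemma opp_series_wt d a i : wt d a -> opp_series a i =
  if 0 <= i + d then (sgn d / (absz (i + d)%R)`!%:R) *: iter (absz (i + d)%R) (L 1) a
  else 0.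
Proof.
move=> ad.
have z j : sgnL0 (zpowL0 A a (i - j%:Z)) = if i + d == j%:Z then sgn d *: a else 0.
  rewrite /zpowL0 (hcomp_wt hA ad) (_ : (- (i - j%:Z) == d) = (i + d == j%:Z)).
    case: eqP => _; first exact: sgnL0_wt.
    by rewrite (sgnL0_wt hA (wt0v A 0)) scaler0.
  by apply/eqP/eqP; lia.
rewrite /opp_series /expzL1; have [id|id] := leP 0 (i + d).
  rewrite (@fsum1 _ _ _ (absz (i + d)%R)) => [|j jd].
    by rewrite z gez0_abs // eqxx iter_L1_scale scalerA mulrC.
  by rewrite z (_ : (_ == _) = false) ?iter_L1_0 ?scaler0 //; lia.
apply: fsbig1 => j _.
by rewrite z (_ : (_ == _) = false) ?iter_L1_0 ?scaler0 //; lia.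
Qed.

Lemma opp_series_fsupp a : fsupp (opp_series a).
Proof.
elim/(homogeneous_ind hA): a => [u v IHu IHv|d a ad].
  have [s Hs] := fsupp_lin 1 IHu IHv; exists s => i /Hs <-.
  by rewrite -opp_series_lin scale1r.
have [N HN] := L1_nilpotent hA a.
exists [seq j%:Z - d | j <- iota 0 N] => i iN; rewrite (opp_series_wt _ ad).
case: ifP => // id; rewrite HN ?scaler0 // leqNgt; apply: contra iN => lt.
by apply/mapP; exists (absz (i + d)%R); rewrite ?mem_iota //; lia.
Qed.

Lemma Yinv_lin (x : C) u v n c : Yinv A (opp_series (x *: u + v)) n c =
  x *: Yinv A (opp_series u) n c + Yinv A (opp_series v) n c.
Proof.
have supp a : fsupp (fun i => Y (opp_series a i) (- n - 2 - i) c).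
  by have [s Hs] := opp_series_fsupp a; exists s => i /Hs ->; exact: nprod0.
rewrite -fsum_lin //; apply: eq_fsbigr => i _.
by rewrite opp_series_lin (nprodD hA) (nprodZ hA).
Qed.

(** The dictionary between the invariance axiom and modes. The term with [L_1^j a] has degree
    [j - d] and doubled weight [d - 2 j], so its product index always belongs to the opposite of the
    mode number of [a_(n)]. *)
Lemma Yinv_wt d a n c : wt d a ->
  Yinv A (opp_series a) n c = mode (expsgn a) (- ((n + 1) * 2 - d)) c.
Proof.
move=> ad; have [N HN] := L1_nilpotent hA a.
rewrite (expsgn_wt ad) (@fsum_ord _ _ N) => [|j /HN ->]; last by rewrite scaler0.
rewrite (mode_sum hA) /Yinv (@fsum_seq _ _ _ [seq j%:Z - d | j <- iota 0 N]).
- rewrite big_map -{1}[N]subn0 big_mkord; apply: eq_bigr => j _.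
  rewrite (opp_series_wt _ ad) subrK /= (nprodZ hA) (modeZ hA); congr (_ *: _).
  by rewrite (mode_even (n := - n - 2 - (j%:Z - d)) hA _ (wt_iter_L1 hA j ad)) //; lia.
- by rewrite map_inj_uniq ?iota_uniq // => j j' /addIr; case.
- move=> i iN; rewrite (opp_series_wt _ ad); case: ifP => id; last exact: nprod0.
  rewrite HN ?scaler0 ?(nprod0 hA) // leqNgt; apply: contra iN => lt.
  by apply/mapP; exists (absz (i + d)%R); rewrite ?mem_iota //; lia.
Qed.

End ExpSign.

(** * Adjoints *)

Section ScalarProduct.
Variables (R : realType) (V : lmodType R[i]) (A : vosa_data V).
Hypothesis hA : is_vosa A.
Variable dot : V -> V -> R[i].
Hypothesis hdot : normalized_scalar_product A dot.
Local Notation C := R[i].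
Local Notation Y := (nprod A).
Local Notation T := (transl A).
Local Notation L := (L A).
Local Notation wt := (wt A).

Lemma dotC u v : dot v u = (dot u v)^*.
Proof. by case: hdot. Qed.

Lemma dot_linr u (x : C) v w : dot u (x *: v + w) = x * dot u v + dot u w.
Proof. by case: hdot. Qed.

Lemma dotDr u v w : dot u (v + w) = dot u v + dot u w.
Proof. by rewrite -{1}[v]scale1r dot_linr mul1r. Qed.

Lemma dot0r u : dot u 0 = 0.
Proof. by apply: (addIr (dot u 0)); rewrite -dotDr !add0r. Qed.

Lemma dotZr u (x : C) v : dot u (x *: v) = x * dot u v.
Proof. by rewrite -[x *: v]addr0 dot_linr dot0r addr0. Qed.

Lemma dotNr u v : dot u (- v) = - dot u v.
Proof. by rewrite -scaleN1r dotZr mulN1r. Qed.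

Lemma dotBr u v w : dot u (v - w) = dot u v - dot u w.
Proof. by rewrite dotDr dotNr. Qed.

Lemma dot0l u : dot 0 u = 0.
Proof. by rewrite dotC dot0r rmorph0. Qed.

Lemma dotDl u v w : dot (u + v) w = dot u w + dot v w.
Proof. by rewrite dotC dotDr rmorphD /= -!dotC. Qed.

Lemma dotZl (x : C) u v : dot (x *: u) v = x^* * dot u v.
Proof. by rewrite dotC dotZr rmorphM /= -dotC. Qed.

Lemma dotNl u v : dot (- u) v = - dot u v.
Proof. by rewrite dotC dotNr rmorphN /= -dotC. Qed.

Lemma dotBl u v w : dot (u - v) w = dot u w - dot v w.
Proof. by rewrite dotDl dotNl. Qed.

Lemma dot_suml (I : Type) (s : seq I) (F : I -> V) v :
  dot (\sum_(i <- s) F i) v = \sum_(i <- s) dot (F i) v.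
Proof.
elim: s => [|i s IH]; first by rewrite !big_nil dot0l.
by rewrite !big_cons dotDl IH.
Qed.

Lemma dot_sumr (I : Type) (s : seq I) (F : I -> V) v :
  dot v (\sum_(i <- s) F i) = \sum_(i <- s) dot v (F i).
Proof.
elim: s => [|i s IH]; first by rewrite !big_nil dot0r.
by rewrite !big_cons dotDr IH.
Qed.

Lemma dot_eq0 u : dot u u = 0 -> u = 0.
Proof.
move=> u0; apply/eqP; apply: contraT => un0.
by case: hdot => _ _ /(_ u un0); rewrite u0 ltxx.
Qed.

Lemma dot_inj u v : (forall w, dot w u = dot w v) -> u = v.
Proof.
by move=> uv; apply: subr0_eq; apply: dot_eq0; rewrite dotBr uv subrr.
Qed.

Lemma dot_subspace (x : C) w u v :
  dot u w = 0 -> dot v w = 0 -> dot (x *: u + v) w = 0.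
Proof. by move=> u0 v0; rewrite dotDl dotZl u0 v0 mulr0 addr0. Qed.

(** Gram-Schmidt, where lying in the span of [s] is expressed as lying in every subspace that
    contains [s]. The vector [r] is the part of [u0] orthogonal to the tail, and [x] is the
    coefficient of the projection onto it. *)
Lemma orthogonal_projection (s : seq V) v : exists w,
  (forall S : set V, is_subspace S -> (forall u, u \in s -> S u) -> S w) /\
  forall u, u \in s -> dot u (v - w) = 0.
Proof.
elim: s v => [|u0 s IH] v; first by exists 0; split=> // S [].
have [w [wS wo]] := IH v; have [w0 [w0S w0o]] := IH u0.
pose r := u0 - w0.
have rS S : is_subspace S -> (forall u, u \in u0 :: s -> S u) -> S r.
  move=> SS Su; rewrite /r addrC -scaleN1r; case: (SS) => _; apply.
    by apply: w0S => // u us; apply: Su; rewrite inE us orbT.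
  by apply: Su; rewrite inE eqxx.
pose x : C := dot r (v - w) / dot r r.
exists (x *: r + w); split=> [S SS Su|].
  case: (SS) => _; apply; first exact: rS.
  by apply: wS => // u us; apply: Su; rewrite inE us orbT.
have orth_s u : u \in s -> dot u (v - (x *: r + w)) = 0.
  by move=> us; rewrite opprD addrCA dotDr dotNr dotZr /r w0o // mulr0 oppr0 add0r wo.
move=> u; rewrite inE => /orP[/eqP ->|]; last exact: orth_s.
rewrite -(subrK w0 u0) -/r dotDl.
have -> : dot w0 (v - (x *: r + w)) = 0.
  apply: (w0S [set u | dot u (v - (x *: r + w)) = 0]) => [|u' /orth_s //].
  by split=> [|y u1 u2 /=]; [exact: dot0l | exact: dot_subspace].
rewrite addr0 opprD addrCA dotDr dotNr dotZr /x.
have [/eqP/dot_eq0 r0|rr] := boolP (dot r r == 0); last by rewrite divfK // addNr.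
by rewrite r0 !dot0l mulr0 oppr0 add0r.
Qed.

Lemma conj_half (k : int) : (k%:~R / 2 : C)^* = k%:~R / 2.
Proof. by rewrite rmorphM fmorphV rmorph_int rmorph_nat. Qed.

Section Virasoro.
Hypothesis dot_T : forall u v, dot (T u) v = dot u (L 1 v).

(* [V_(k/2)] is the orthogonal sum of [T V_(k/2-1)] and its quasi-primary
   vectors, because [T] and [L 1] are mutually adjoint. *)
Lemma quasi_primary_ind (P : V -> Prop) :
  (forall (x : C) u v, P u -> P v -> P (x *: u + v)) ->
  (forall u, P u -> P (T u)) ->
  (forall d u, wt d u -> L 1 u = 0 -> P u) -> forall v, P v.
Proof.
move=> Plin PT Pqp.
have P0 : P 0 by apply: (Pqp 0); [exact: wt0v | rewrite linear0].
have PD u v : P u -> P v -> P (u + v).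
  by move=> ? ?; rewrite -[u]scale1r; apply: Plin.
apply: (homogeneous_ind hA) => // d.
have [K wK] := vosa_wt_bounded hA.
suff H (j : nat) : forall d v, d < K + j%:Z -> wt d v -> P v.
  by move=> v; apply: (H (absz (d + 1 - K)%R)); lia.
elim: j {d} => [|j IH] d v.
  by rewrite addr0 => dK; rewrite wK //= => ->.
move=> dj vd; have [m [e wE]] := vosa_wt_fin hA (d - 2).
have we i : wt (d - 2) (e i).
  rewrite wE; exists (fun k => (k == i)%:R) => //=.
  rewrite (bigD1 i) //= eqxx scale1r big1 ?addr0 // => k /negbTE ->.
  by rewrite scale0r.
have [w [wS wo]] := orthogonal_projection [seq T (e i) | i <- enum 'I_m] v.
have [u [ud wu]] : exists u, wt (d - 2) u /\ w = T u.
  apply: (wS [set w | exists u, wt (d - 2) u /\ w = T u]).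
    split=> [|x u1 u2 [v1 [w1 ->]] [v2 [w2 ->]] /=].
      by exists 0; split; [exact: wt0v | rewrite linear0].
    by exists (x *: v1 + v2); split; [exact: wt_lin | rewrite linearP].
  by move=> _ /mapP[i _ ->]; exists (e i).
have wd : wt d w by rewrite wu; apply: wt_eq (wt_transl hA ud); rewrite subrK.
rewrite -(subrK w v); apply: PD; last first.
  by rewrite wu; apply: PT; apply: IH ud; lia.
have wtvw : wt d (v - w) by rewrite addrC -scaleN1r; apply: wt_lin.
(* [L 1 (v - w)] is a combination of the [e i], and pairing it with [e i] amounts to pairing [v - w]
   with [T (e i)], which gives 0. So it is orthogonal to itself. *)
apply: (Pqp d) => //; apply: dot_eq0.
have : wt (d - 2) (L 1 (v - w)) by apply: wt_L1.
rewrite {1}wE => -[x _ xE]; rewrite -{1}xE dot_suml big1 // => i _.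
by rewrite dotZl -dot_T wo ?mulr0 //; apply/mapP; exists i; rewrite ?mem_enum.
Qed.

End Virasoro.

End ScalarProduct.

(** * Antilinear maps commuting with [L_0] and [L_1] *)

Section Antilinear.
Variables (R : realType) (V : lmodType R[i]) (A : vosa_data V).
Hypothesis hA : is_vosa A.
Local Notation C := R[i].
Local Notation Y := (nprod A).
Local Notation T := (transl A).
Local Notation L := (L A).
Local Notation wt := (wt A).
Local Notation mode := (mode A).
Local Notation expsgn := (expsgn A).
Local Notation sgn := (sgn R).
Variable f : V -> V.
Hypothesis fal : antilinear f.

Lemma antilinearD u v : f (u + v) = f u + f v.
Proof. by rewrite -{1}[u]scale1r fal rmorph1 scale1r. Qed.

Lemma antilinear0 : f 0 = 0.
Proof. by apply: (addIr (f 0)); rewrite -antilinearD !add0r. Qed.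

Lemma antilinearZ (x : C) u : f (x *: u) = x^* *: f u.
Proof. by rewrite -[x *: u]addr0 fal antilinear0 addr0. Qed.

Lemma antilinear_sum (I : Type) (s : seq I) (F : I -> V) :
  f (\sum_(i <- s) F i) = \sum_(i <- s) f (F i).
Proof.
elim: s => [|i s IH]; first by rewrite !big_nil antilinear0.
by rewrite !big_cons antilinearD IH.
Qed.

Hypothesis f_L0 : forall a, f (L 0 a) = L 0 (f a).

Lemma antilinear_wt d a : wt d a -> wt d (f a).
Proof.
by move=> ad; rewrite /Defs.wt /= -f_L0 (L0_wt ad) antilinearZ conj_half.
Qed.

Hypothesis f_L1 : forall a, f (L 1 a) = L 1 (f a).

(** The coefficients [sgn d / j!] of [E] are real. This serves both a given PCT operator and the one
    constructed from [bar]. *)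
Lemma antilinear_expsgn a : f (expsgn a) = expsgn (f a).
Proof.
elim/(homogeneous_ind hA): a => [u v IHu IHv|d a ad].
  by rewrite (expsgnD hA) !antilinearD (expsgnD hA) IHu IHv.
rewrite (expsgn_wt hA ad) (expsgn_wt hA (antilinear_wt ad)).
have [N HN] := L1_nilpotent hA a.
have fiter j : f (iter j (L 1) a) = iter j (L 1) (f a).
  by elim: j => //= j <-.
rewrite !(@fsum_ord _ _ N) => [|j Nj|j /HN ->].
- rewrite antilinear_sum; apply: eq_bigr => j _.
  by rewrite antilinearZ fiter rmorphM fmorphV rmorph_nat /= sgn_conj.
- by rewrite -fiter HN // antilinear0 scaler0.
- by rewrite scaler0.
Qed.

End Antilinear.

(** * From the PCT operator to the adjoint involution *)

Section PCT.
Variables (R : realType) (V : lmodType R[i]) (A : vosa_data V).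
Hypothesis hA : is_vosa A.
Variable dot : V -> V -> R[i].
Hypothesis hdot : normalized_scalar_product A dot.
Local Notation C := R[i].
Local Notation Y := (nprod A).
Local Notation T := (transl A).
Local Notation L := (L A).
Local Notation wt := (wt A).
Local Notation mode := (mode A).
Local Notation expsgn := (expsgn A).
Local Notation sgn := (sgn R).

Lemma mode_expsgn_odd d a k c : wt d a -> (forall n, k <> (n + 1) * 2 - d) ->
  mode (expsgn a) k c = 0.
Proof.
move=> ad kn; have [N HN] := L1_nilpotent hA a.
rewrite (expsgn_wt hA ad) (@fsum_ord _ _ N) => [|j /HN ->]; last by rewrite scaler0.
rewrite (mode_sum hA) big1 // => j _; rewrite (modeZ hA).
rewrite (mode_odd hA _ (wt_iter_L1 hA j ad)) ?scaler0 // => n kE.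
by case: (kn (n + j%:Z)); lia.
Qed.

Lemma index_opp d (k : int) : (forall n, k <> (n + 1) * 2 - d) ->
  forall n, - k <> (n + 1) * 2 - d.
Proof. by move=> kn n kE; case: (kn (d - n - 2)); lia. Qed.

Lemma PCT_adjoint_involution theta : is_PCT A dot theta ->
  adjoint_involution A dot (fun a => expsgn (theta a)).
Proof.
case=> al _ prodE _ confE invol inv.
have tL n a : theta (L n a) = L n (theta a) by rewrite /Defs.L prodE confE.
have tw d a : wt d a -> wt d (theta a) by apply: antilinear_wt.
split.
- by move=> x u v; rewrite al (expsgn_lin hA).
- move=> a; rewrite (antilinear_expsgn hA al) // invol.
  exact: expsgnK.
- by rewrite confE (expsgn_conf hA).
- move=> a b c k; elim/(homogeneous_ind hA): a => [u v IHu IHv|d a ad].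
    by rewrite (antilinearD al) (expsgnD hA) !(modeD hA) (dotDl hdot)
      (dotDr hdot) IHu IHv.
  have [[n kE]|kn] := index_parity d k; last first.
    rewrite (mode_odd hA _ ad kn) (dot0l hdot).
    by rewrite (mode_expsgn_odd _ (tw _ _ ad) (index_opp kn)) (dot0r hdot).
  (* Invariance describes the adjoint of the products with [theta a']; it is applied to
     [a' = theta a]. *)
  rewrite (mode_even hA _ ad kE) -{1}(invol a) inv.
  by rewrite (Yinv_wt hA _ _ (tw _ _ ad)) kE.
Qed.

(** * From the adjoint involution to the PCT operator *)

Section Adjoint.
Variable bar : V -> V.
Hypothesis hbar : adjoint_involution A dot bar.

Let adj a b c k : dot (mode a k b) c = dot b (mode (bar a) (- k) c).
Proof. exact: adj_mode hbar _ _ _ _. Qed.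

Let bar_al : antilinear bar := adj_antilinear hbar.
Let barK a : bar (bar a) = a := adj_invol hbar a.

(** The scalar product is nondegenerate and a vector is determined by its modes. Values of [bar] are
    computed below by exhibiting adjoints. *)
Lemma adjoint_unique a b :
  (forall u v k, dot (mode a k u) v = dot u (mode b (- k) v)) -> bar a = b.
Proof.
move=> ab; apply: (mode_inj hA) => k v; apply: (dot_inj hdot) => u.
by rewrite -[k]opprK -adj ab.
Qed.

Lemma bar_vac : bar (vac A) = vac A.
Proof.
apply: adjoint_unique => u v k; rewrite !(mode_vac hA) oppr_eq0.
by case: eqP => // _; rewrite (dot0l hdot) (dot0r hdot).
Qed.

Lemma dot_L n u v : dot (L n u) v = dot u (L (- n) v).
Proof. by rewrite -!(mode_conf hA) adj (adj_conf hbar) mulNr. Qed.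

Lemma dot_T u v : dot (T u) v = dot u (L 1 v).
Proof. by rewrite -(vosa_L_transl hA) dot_L. Qed.

(** The adjoint of the commutator of [T] with a mode is a commutator of [L 1] with a mode of
    [bar a]; comparing [T_mode] at index [k + 2] with [L1_mode] isolates [L 0 a]. *)
Lemma bar_L0 a : bar (L 0 a) = L 0 (bar a) + L 1 (bar a).
Proof.
apply: adjoint_unique => u v k.
have TE := T_mode hA a (k + 2) u; rewrite addrK in TE.
have -> : mode (L 0 a) k u = (1 - (k + 2)%:~R / 2 : C) *: mode a k u -
    (T (mode a (k + 2) u) - mode a (k + 2) (T u)) by rewrite TE subKr.
rewrite !(dotBl hdot) (dotZl hdot) dot_T !adj dot_T.
rewrite rmorphB rmorph1 /= conj_half -(dotZr hdot) -!(dotBr hdot); congr dot.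
have := L1_mode hA (bar a) (- (k + 2)) v.
rewrite (_ : - (k + 2) + 2 = - k) ?(modeD hA); last lia.
rewrite opprB => ->; rewrite mulrNz mulNr addrC subrK; exact: addrC.
Qed.

(** Applying [bar] to [bar_L0] at [bar a] gives [L_0] back plus two corrections, which must cancel
    because [bar] is an involution. *)
Lemma bar_L1 a : bar (L 1 a) = - L 1 (bar a).
Proof.
have e := congr1 bar (bar_L0 (bar a)).
rewrite !barK (antilinearD bar_al) bar_L0 in e.
apply/eqP; rewrite -addr_eq0 addrC; apply/eqP; apply: (addrI (L 0 (bar a))).
by rewrite addr0 addrA -e.
Qed.

(** Adjoint of [mode_transl], in which [bar_L0] evaluates the term with [L 0 a]. *)
Lemma bar_T a : bar (T a) = - (T (bar a) + L 0 (bar a) *+ 2 + L 1 (bar a)).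
Proof.
apply: adjoint_unique => u v k.
rewrite (mode_transl hA) (dotBl hdot) (dotZl hdot) !adj bar_L0.
rewrite rmorphN /= conj_half -(dotZr hdot) -(dotBr hdot); congr dot.
rewrite -[- (T _ + _ + _)]scaleN1r (modeZ hA) scaleN1r mulr2n !(modeD hA).
rewrite (mode_transl hA) mulrNz mulNr opprK [_ - _ + (_ + _)]addrA subrK.
by rewrite scaleNr -opprD addrA.
Qed.

(** The formula of the theorem solved for the PCT operator, using [E^2 = 1]. *)
Definition theta (a : V) : V := expsgn (bar a).

Lemma theta_al : antilinear theta.
Proof. by move=> x u v; rewrite /theta bar_al (expsgn_lin hA). Qed.

Lemma theta_L0 a : theta (L 0 a) = L 0 (theta a).
Proof.
rewrite /theta bar_L0 (expsgnD hA) (expsgn_L0 hA) (expsgn_L1 hA).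
by rewrite addrK.
Qed.

Lemma theta_L1 a : theta (L 1 a) = L 1 (theta a).
Proof. by rewrite /theta bar_L1 (expsgnN hA) (expsgn_L1 hA) opprK. Qed.

Lemma theta_T a : theta (T a) = T (theta a).
Proof.
rewrite /theta bar_T (expsgnN hA) mulr2n !(expsgnD hA) (expsgn_T hA).
rewrite (expsgn_L1 hA) !(expsgn_L0 hA) mulr2n.
rewrite [L 0 _ + L 1 _ + (L 0 _ + L 1 _)]addrACA.
set l0 := L 0 _; set l1 := L 1 _.
rewrite -[X in - X]addrA [_ + (l1 + l1)]addrA addrK.
by rewrite opprD opprK -[T _ + _ + l1]addrA addrK.
Qed.

Lemma bar_theta a : bar a = expsgn (theta a).
Proof. by rewrite /theta (expsgnK hA). Qed.

Lemma thetaK : involutive theta.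
Proof.
move=> a; rewrite {2}/theta (antilinear_expsgn hA theta_al theta_L0 theta_L1).
by rewrite -bar_theta barK.
Qed.

Lemma theta_wt d a : wt d a -> wt d (theta a).
Proof. exact: (antilinear_wt theta_al theta_L0). Qed.

Lemma theta_vac : theta (vac A) = vac A.
Proof. by rewrite /theta bar_vac (expsgn_vac hA). Qed.

Lemma theta_conf : theta (conf A) = conf A.
Proof. by rewrite /theta (adj_conf hbar) (expsgn_conf hA). Qed.

(** On a quasi-primary vector [E] is just a sign, so the adjoint of a single product is again a
    single product, at the reflected index. *)
Lemma adj_primary d a n u v : wt d a -> L 1 a = 0 ->
  dot (Y a n u) v = sgn d * dot u (Y (theta a) (d - 2 - n) v).
Proof.
move=> ad La; have tad := theta_wt ad.
rewrite -(mode_even hA _ ad (erefl _)) adj bar_theta.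
rewrite (expsgn_primary hA tad) -?theta_L1 ?La ?(antilinear0 theta_al) //.
rewrite (modeZ hA) (dotZr hdot) (mode_even (n := d - 2 - n) hA _ tad) //; lia.
Qed.

Lemma conj_binz x j : ((-1) ^+ j * binz C x j)^* = (-1) ^+ j * binz C x j.
Proof.
rewrite rmorphM rmorphXn rmorphN rmorph1 /=; congr (_ * _).
rewrite /binz rmorphM fmorphV rmorph_nat rmorph_prod; congr (_ / _).
by apply: eq_bigr => i _; rewrite rmorph_int.
Qed.

(** Adjunction reverses the order of the two operators and reflects their indices. With the shift by
    [n] the terms correspond one by one, and the expansion coefficients are real. *)
Lemma adj_expand d e a b n m k u v :
  wt d a -> L 1 a = 0 -> wt e b -> L 1 b = 0 ->
  dot (expand n (fun m k => Y a m (Y b k u)) m k) v =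
  sgn d * sgn e * dot u (expand n (fun k m => Y (theta b) k (Y (theta a) m v))
    (e - 2 - k - n) (d - 2 - m - n)).
Proof.
move=> ad La be Lb.
have [K1 F1] := wbounded_nprod2 hA a b u.
have [K2 F2] := wbounded_nprod2 hA (theta b) (theta a) v.
pose N := maxn (absz (K1 - k)%R) (absz (K2 - (d - 2 - m - n))%R).
rewrite (@expand_ord _ _ _ _ _ _ _ N F1); last by rewrite /N; lia.
rewrite (@expand_ord _ _ _ _ _ _ _ N F2); last by rewrite /N; lia.
rewrite (dot_suml hdot) (dot_sumr hdot) mulr_sumr; apply: eq_bigr => j _.
rewrite (dotZl hdot) (dotZr hdot) conj_binz [sgn d * sgn e * (_ * _)]mulrCA; congr (_ * _).
rewrite (adj_primary _ _ _ ad La) (adj_primary _ _ _ be Lb) mulrA.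
by congr (_ * dot u (Y _ _ (Y _ _ _))); lia.
Qed.

Lemma adj_bop (s : bool) d e a b n m k u v :
  wt d a -> L 1 a = 0 -> wt e b -> L 1 b = 0 ->
  dot (bop A ((-1) ^+ s) a b n m k u) v =
  - ((-1) ^+ s * (-1) ^ n * (sgn d * sgn e)) *
  dot u (bop A ((-1) ^+ s) (theta a) (theta b) n (d - 2 - m - n) (e - 2 - k - n) v).
Proof.
move=> ad La be Lb; rewrite /bop !(dotBl hdot) !(dotBr hdot) (dotZl hdot) (dotZr hdot).
rewrite (adj_expand _ _ _ _ _ ad La be Lb) (adj_expand _ _ _ _ _ be Lb ad La).
set x := dot u _; set y := dot u _.
have -> : ((-1) ^+ s * (-1) ^ n : C)^* = (-1) ^+ s * (-1) ^ n.
  by apply: conj_Creal; rewrite rpredM ?rpredX ?rpredXz ?rpredN ?rpred1.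
have : ((-1) ^+ s * (-1) ^ n : C) * ((-1) ^+ s * (-1) ^ n) = 1.
  by rewrite mulrACA signz_sq mulr1 -signr_addb addbb.
set c := (-1) ^+ s * (-1) ^ n => cc.
rewrite -[sgn d * sgn e * x]mul1r -cc; ring.
Qed.

(** The [j]-th application of [L 1], counted from 0, raises the product index by one and contributes
    the factor [d - 2 - n - j]; these build up a falling factorial. *)
Lemma iter_L1_primary d a b n j : wt d a -> L 1 a = 0 -> L 1 b = 0 ->
  iter j (L 1) (Y a n b) = (j`!%:R * binz C (d - 2 - n) j) *: Y a (n + j%:Z) b.
Proof.
move=> ad La Lb; elim: j => [|j IH].
  by rewrite /= fact0 binz0 mul1r scale1r addr0.
rewrite iterS IH linearZ_LR.
have := L1_nprod hA a (n + j%:Z) b; rewrite La Lb linear0 subr0 (nprod0 hA) add0r => ->.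
rewrite (L0_wt ad) (nprodZ hA) -[_ *: _ *+ 2]scaler_nat scalerA -scalerBl scalerA.
congr (_ *: Y _ _ _); last by lia.
rewrite factS natrM -[RHS]mulrA [RHS]mulrCA binz_rec.
rewrite -[LHS]mulrA; congr (_ * _); rewrite [LHS]mulrC; congr (_ * _).
by field.
Qed.

(** The [j!] of [iter_L1_primary] cancels that of the exponential, and the remaining binomial
    coefficients are those of [assoc]. *)
Lemma mode_expsgn_primary d e a b n k v :
  wt d a -> L 1 a = 0 -> wt e b -> L 1 b = 0 ->
  mode (expsgn (Y a n b)) (- ((k + 1) * 2 - (d + e - 2 * n - 2))) v =
  sgn (d + e - 2 * n - 2) *: assoc A a b n (d - 2 - n) (e - 2 - k - n) v.
Proof.
move=> ad La be Lb; have fx := wt_nprod hA n ad be.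
have [K YK] := vosa_Y_trunc hA a b; have [N HN] := L1_nilpotent hA (Y a n b).
pose M := maxn N (absz (K - n)%R).
rewrite (expsgn_wt hA fx) (@fsum_ord _ _ M) => [|j]; last first.
  by rewrite geq_max => /andP[/HN -> _]; rewrite scaler0.
rewrite (@assoc_ord _ _ _ hA K M) //; last by rewrite /M; lia.
rewrite (mode_sum hA) scaler_sumr; apply: eq_bigr => j _.
rewrite (modeZ hA) (mode_even (n := d - 2 - n + (e - 2 - k - n) - j%:Z) hA _
  (wt_iter_L1 hA j fx)); last by lia.
rewrite (iter_L1_primary _ _ ad La Lb) (nprodZ hA) !scalerA; congr (_ *: _).
by rewrite mulrA divfK // pnatr_eq0 -lt0n fact_gt0.
Qed.

Lemma theta_nprod_primary d e a b n :
  wt d a -> L 1 a = 0 -> wt e b -> L 1 b = 0 ->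
  theta (Y a n b) = Y (theta a) n (theta b).
Proof.
move=> ad La be Lb; have [tad tbe] := (theta_wt ad, theta_wt be).
have Lta : L 1 (theta a) = 0 by rewrite -theta_L1 La (antilinear0 theta_al).
have Ltb : L 1 (theta b) = 0 by rewrite -theta_L1 Lb (antilinear0 theta_al).
have fx := wt_nprod hA n ad be; have fy := wt_nprod hA n tad tbe.
suff e1 : bar (Y a n b) = expsgn (Y (theta a) n (theta b)).
  by rewrite {1}/theta e1 (expsgnK hA).
apply: adjoint_unique => u v k.
have [[k' ->]|kn] := index_parity (d + e - 2 * n - 2) k; last first.
  rewrite (mode_odd hA _ fx kn) (dot0l hdot).
  by rewrite (mode_expsgn_odd _ fy (index_opp kn)) (dot0r hdot).
rewrite (mode_even hA _ fx (erefl _)) (mode_expsgn_primary _ _ _ tad Lta tbe Ltb).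
(* The product [a_(n) b] is the coefficient [m = 0] of [bop]; its adjoint has [m = d - 2 - n], the
   exponent required by [mode_expsgn_primary]. *)
rewrite -(bop_nprod hA _ _ _ (par_wt hA ad) (par_wt hA be)).
rewrite (adj_bop _ _ _ _ _ _ ad La be Lb) subr0.
rewrite (borcherds_identity hA _ _ _ _ (par_wt hA tad) (par_wt hA tbe)).
rewrite (dotZr hdot); congr (_ * _).
(* By [sgnD], the sign of graded locality is what turns [sgn d * sgn e] into the sign attached to
   the weight of [a_(n) b]. *)
rewrite (_ : d + e - 2 * n - 2 = d + e - (n + 1) * 2); last lia.
rewrite sgn_shift signzS sgnD mulNr; congr (- _).
by rewrite !mulrA; congr (_ * _ * _); exact: mulrC.
Qed.

(** Induction from quasi-primary vectors, first in [a] and then in [b]. Translation covariance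
    removes a [T] from either argument, compatibly with [theta], since [theta] commutes with [T] and
    the coefficients are integers. *)
Lemma theta_nprod a n b : theta (Y a n b) = Y (theta a) n (theta b).
Proof.
move: n; apply: (quasi_primary_ind hA hdot dot_T
  (P := fun a => forall n, theta (Y a n b) = Y (theta a) n (theta b))).
- move=> x u v IHu IHv n.
  by rewrite (nprodD hA) (nprodZ hA) !theta_al IHu IHv (nprodD hA) (nprodZ hA).
- move=> u IHu n; rewrite (nprod_transl hA) theta_T (nprod_transl hA).
  by rewrite (antilinearZ theta_al) rmorphN rmorph_int IHu.
move=> d u ud Lu; apply: (quasi_primary_ind hA hdot dot_T
  (P := fun b => forall n, theta (Y u n b) = Y (theta u) n (theta b))).
- by move=> x w w' IHw IHw' n; rewrite linearP !theta_al IHw IHw' linearP.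
- move=> w IHw n.
  have H a' b' : Y a' n (T b') = T (Y a' n b') + n%:~R *: Y a' (n - 1) b'.
    have := vosa_Y_transl hA a' n b'; rewrite scaleNr => /eqP.
    by rewrite subr_eq addrC => /eqP ->; rewrite addrNK.
  rewrite theta_T !H (antilinearD theta_al) theta_T IHw (antilinearZ theta_al).
  by rewrite rmorph_int IHw.
by move=> e w we Lw n; apply: theta_nprod_primary ud Lu we Lw.
Qed.

Lemma theta_PCT : is_PCT A dot theta.
Proof.
split.
- exact: theta_al.
- by exists theta; exact: thetaK.
- exact: theta_nprod.
- exact: theta_vac.
- exact: theta_conf.
- exact: thetaK.
- move=> a b c n; rewrite -/(opp_series A a).
  elim/(homogeneous_ind hA): a => [u v IHu IHv|d a ad].
    rewrite (antilinearD theta_al) (nprodD hA) (dotDl hdot) IHu IHv.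
    have := Yinv_lin hA 1 u v n c; rewrite !scale1r => ->.
    by rewrite (dotDr hdot).
  rewrite -(mode_even hA _ (theta_wt ad) (erefl _)) adj (Yinv_wt hA _ _ ad).
  by rewrite bar_theta thetaK.
Qed.

End Adjoint.
End PCT.

Theorem theorem3p31 (R : realType) (V : lmodType R[i]) (A : vosa_data V)
    (hA : is_vosa A) (dot : V -> V -> R[i])
    (hdot : normalized_scalar_product A dot) :
  (unitary_vosa A dot <-> exists bar : V -> V, adjoint_involution A dot bar) /\
  (forall bar : V -> V, adjoint_involution A dot bar ->
     bar (vac A) = vac A /\
     forall theta : V -> V, is_PCT A dot theta ->
       forall a : V, bar a = expL1 A (sgnL0 A (theta a))).
Proof.
split; first split.
- case=> _ _ [theta htheta]; exists (fun a => expsgn A (theta a)).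
  exact: PCT_adjoint_involution.
- case=> bar hbar; split=> //; exists (theta A bar).
  exact: theta_PCT.
move=> bar hbar; split; first exact: bar_vac hbar.
(* Every PCT operator yields an adjoint involution by the first direction, and uniqueness of
   adjoints identifies it with [bar]. *)
move=> theta htheta a; apply: (adjoint_unique hA hdot hbar) => u v k.
exact: adj_mode (PCT_adjoint_involution hA hdot htheta) _ _ _ _.
Qed.
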